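(* Let $E$ be a field of characteristic different from $2$. Assume that in $E[X]$ every monic square-free polynomial of degree $4$ divides a square-reflexive polynomial. Then $u(E)\leq 2$.
   Context: $u(E)\in\mathbb{N}\cup\{\infty\}$ is the supremum of the dimensions of anisotropic (regular) quadratic forms over $E$; a form is anisotropic if it has no nontrivial zero. For a commutative ring $R$ let $R^\times$ be its group of units and $R^{\times 2}=\{x^2\mid x\in R^\times\}$; an element of $R$ is square-free if it is not equal to $x^2y$ for any $x\in R\setminus R^\times$ and $y\in R$. For a nonzero $f\in E[X]$ put $E_f=E[X]/(f)$, let $\mathrm{N}_{E_f/E}:E_f\to E$ be the norm of this finite-dimensional $E$-algebra and let $\mathrm{lc}(f)$ be the leading coefficient of $f$. A square-free polynomial $f\in E[X]\setminus\{0\}$ is called square-reflexive if for every $\alpha\in E_f^\times$ with $\mathrm{N}_{E_f/E}(\alpha)\in E^{\times 2}\cup \mathrm{lc}(f)E^{\times 2}$ there exists a polynomial $g\in E[X]$ coprime to $f$ such that $g+(f)\in\alpha E_f^{\times 2}$ and $f+(g)\in E_g^{\times 2}$. *)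

(* Defs.v *)
From HB Require Import structures.
From mathcomp Require Import all_boot all_order all_algebra.
From mathcomp Require Import boolp classical_sets constructive_ereal.

Set Implicit Arguments.
Unset Strict Implicit.
Unset Printing Implicit Defensive.

Import Order.TTheory GRing.Theory Num.Theory.
Local Open Scope ring_scope.

(* Everything that is also applied to quotients E[X]/(f) is stated for pzRings,
   since E[X]/(f) is the zero ring when f is a nonzero constant. *)
Section Units.
Variable R : comPzRingType.
Implicit Types x y : R.

Definition is_unit x : Prop := exists y, x * y = 1.

Definition is_unit_square x : Prop := exists2 y, is_unit y & x = y ^+ 2.

Definition square_free x : Prop :=
  ~ exists y z, ~ is_unit y /\ x = y ^+ 2 * z.

End Units.

Section PolyQuotient.
Variables (E : fieldType) (f : {poly E}).

(* E[X]/(f) for f != 0: the remainders modulo f, with multiplication modulo f.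
   Unlike {poly %/ f}, this does not require f to be monic or nonconstant.
   For f = 0 it is the zero ring, not E[X]. *)
Definition polyquo : Type := {poly_(size f).-1 E}.

HB.instance Definition _ := Vector.on polyquo.

Definition polyquo_class (p : {poly E}) : polyquo :=
  npolyp (size f).-1 (p %% f).

Definition polyquo_mul (a b : polyquo) : polyquo :=
  polyquo_class ((a : {poly E}) * (b : {poly E})).

Lemma polyquo_classE p : f != 0 -> polyquo_class p = p %% f :> {poly E}.
Proof.
move=> f0; rewrite /polyquo_class npolypK // -ltnS prednK ?size_poly_gt0 //.
by rewrite ltn_modp.
Qed.

Lemma polyquo_modp (a : polyquo) : f != 0 -> (a : {poly E}) %% f = a.
Proof.
move=> f0; rewrite modp_small // (leq_ltn_trans (size_npoly a)) //.
by rewrite prednK ?size_poly_gt0.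
Qed.

Lemma polyquo_eq (a b : polyquo) :
  (f != 0 -> a = b :> {poly E}) -> a = b.
Proof.
have [f0 _|_ eq_ab] := eqVneq f 0; last exact/val_inj/eq_ab.
apply/npolyP => i; rewrite !nth_default //.
  by rewrite (leq_trans (size_npoly b)) // f0 size_poly0.
by rewrite (leq_trans (size_npoly a)) // f0 size_poly0.
Qed.

Lemma polyquo_mulA : associative polyquo_mul.
Proof.
move=> a b c; apply: polyquo_eq => f0; rewrite !polyquo_classE //.
by rewrite modp_mul mulrA [in RHS]mulrC modp_mul [polyn c * _]mulrC.
Qed.

Lemma polyquo_mulC : commutative polyquo_mul.
Proof. by move=> a b; rewrite /polyquo_mul mulrC. Qed.

Lemma polyquo_mul1 : left_id (polyquo_class 1) polyquo_mul.
Proof.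
move=> a; apply: polyquo_eq => f0; rewrite !polyquo_classE //.
by rewrite mulrC modp_mul mulr1 polyquo_modp.
Qed.

Lemma polyquo_mulDl : left_distributive polyquo_mul +%R.
Proof.
move=> a b c; apply: polyquo_eq => f0.
by rewrite raddfD /= !polyquo_classE // raddfD /= mulrDl modpD.
Qed.

HB.instance Definition _ := GRing.Zmodule_isComPzRing.Build polyquo
  polyquo_mulA polyquo_mulC polyquo_mul1 polyquo_mulDl.

(* Determinant of multiplication by a, in the basis 1, X, ..., X^(deg f - 1). *)
Definition polyquo_norm (a : polyquo) : E :=
  \det (\matrix_(i < (size f).-1, j < (size f).-1)
          (polyn (a * polyquo_class 'X^i : polyquo))`_j).

End PolyQuotient.

Definition square_reflexive (E : fieldType) (f : {poly E}) : Prop :=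
  [/\ f != 0, square_free f &
   forall a : polyquo f, is_unit a ->
     is_unit_square (polyquo_norm a) \/
       (exists2 e : E, is_unit_square e & polyquo_norm a = lead_coef f * e) ->
     exists g : {poly E},
       [/\ coprimep g f,
           exists2 s : polyquo f, is_unit_square s & polyquo_class f g = a * s
         & is_unit_square (polyquo_class g f)]].

Section QuadraticForms.
Variables (E : fieldType) (V : vectType E).
Implicit Type q : V -> E.

Definition polar q (x y : V) : E := q (x + y) - q x - q y.

(* polar q is symmetric, so linearity in one argument is bilinearity. *)
Definition quadratic_form q : Prop :=
  (forall a x, q (a *: x) = a ^+ 2 * q x) /\ (forall x, scalar (polar q x)).

Definition regular_form q : Prop :=
  forall x, (forall y, polar q x y = 0) -> x = 0.

Definition anisotropic q : Prop := forall x, q x = 0 -> x = 0.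

End QuadraticForms.

Section UInvariant.
Local Open Scope classical_set_scope.
Variable E : fieldType.

Definition anisotropic_dims : set nat :=
  [set n | exists (V : vectType E) (q : V -> E),
    [/\ quadratic_form q, regular_form q, anisotropic q & \dim {:V} = n]].

(* The supremum is taken in \bar int, whose order contains that of
   N together with oo; it exists and is never -oo by u_invariant_sup below. *)
Definition u_invariant : \bar int :=
  supremum -oo%E [set (n%:Z)%:E | n in anisotropic_dims].

Lemma anisotropic_dims0 : anisotropic_dims 0%N.
Proof.
exists 'rV[E]_0, (fun=> 0); split.
- split=> [a x|x a y z]; first by rewrite mulr0.
  by rewrite /polar !subrr mulr0 addr0.
- by move=> x _; exact: thinmx0.
- by move=> x _; exact: thinmx0.
- by rewrite dimvf /dim /= muln0.
Qed.

Lemma u_invariant_sup :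
  supremums [set (n%:Z)%:E | n in anisotropic_dims] u_invariant.
Proof.
set A := [set _ | _ in _].
have A0 : A != set0 by apply/set0P; exists 0%:E, 0%N => //; exact: anisotropic_dims0.
rewrite /u_invariant /supremum -/A (negPf A0).
suff [u uA] : supremums A !=set0 by case: xgetP => [x _ //|/(_ u)/(_ uA)].
have [bA|nbA] := pselect (ubound anisotropic_dims !=set0).
  have [m [m_ub m_lub]] := nat_supremums_neq0 bA.
  exists (m%:Z)%:E; split=> [_ [n /m_ub ? <-]|]; first by rewrite lee_fin lez_nat.
  have : anisotropic_dims m.
    apply: contrapT => nm.
    have m0 : (0 < m)%N.
      by case: m nm {m_ub m_lub} => // /(_ anisotropic_dims0).
    have /m_lub : ubound anisotropic_dims m.-1.
      move=> n dn; have nm1 : (n <= m)%N by exact: m_ub.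
      rewrite leEnat -ltnS prednK // ltn_neqAle nm1 andbT.
      by apply/eqP => e; apply: nm; rewrite -e.
    by rewrite leEnat -ltnS prednK // ltnn.
  by move=> dm y; apply; exists m.
exists +oo%E; split=> [x _|y yA]; first exact: leey.
case: y yA => [r|_|] // yA; last first.
  have /yA // : [set (n%:Z)%:E | n in anisotropic_dims] 0%:E.
  by exists 0%N => //; exact: anisotropic_dims0.
exfalso; apply: nbA; exists `|r|%N => n dn.
have : ((n%:Z)%:E <= r%:E)%E by apply: yA; exists n.
by rewrite lee_fin leEnat -lez_nat => /le_trans; apply; exact: lez_abs.
Qed.

Lemma u_invariant_le (n : nat) :
  (u_invariant <= (n%:Z)%:E)%E <->
  forall m, anisotropic_dims m -> (m <= n)%N.
Proof.
have [ub lub] := u_invariant_sup; split=> [un m dm|dn].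
  rewrite -lez_nat -lee_fin; apply: le_trans un; apply: ub; by exists m.
by apply: lub => _ [m /dn mn <-]; rewrite lee_fin lez_nat.
Qed.

End UInvariant.

(* Main.v *)
From HB Require Import structures.
From mathcomp Require Import all_boot all_order all_algebra.
From mathcomp Require Import constructive_ereal ring zify separable.
Require Import Defs.

Import GRing.Theory.
Local Open Scope ring_scope.

(** If u(E) > 2, then some anisotropic ternary form exists, and after scaling it
    is x^2 - b y^2 - a z^2. There are four distinct points x0, x1, y0, y1 of E for
    which (y0 - x0)(y1 - x0)(y0 - x1)(y1 - x1) is a times a nonzero square
    (cross_ratio_points). The hypothesis, applied to the polynomial h with these
    four roots, implies that the same product is a norm s^2 - b t^2
    (norm_of_roots), and this gives a nontrivial zero of the ternary form.

    Let f be a square-reflexive multiple of h. By the Chinese remainder theorem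
    there is a unit alpha of E_f that is b at the simple roots y0 and y1, and 1
    in the other factor of E_f; its norm is b^2 (interpolating_unit). So there is
    g such that f is a square modulo g, while g is, up to squares, b at y0 and
    y1, and 1 elsewhere modulo f.

    In terms of quaternion algebras, (f, g) over E(X) is then ramified exactly
    like (P, b), where P = (X - y0)(X - y1), except possibly at infinity,
    so that they differ by a constant class. At x0 and x1, where g is a square,
    that class specialises to (P(x0), b) and to (P(x1), b); hence
    (P(x0) P(x1), b) is split, in other words P(x0) P(x1) is a norm from
    E(sqrt b). This is a reciprocity law for the symbol
    {f, g, (X - x0) / (X - x1)}; the proof below replaces Brauer groups by
    quadratic forms.

    For a polynomial G, the form sending p, q to the sum of the residues of
    p q / G is nondegenerate on E[X]/(G), and its Witt class depends only on the
    degree and the leading coefficient of G (pair_lagrangian). For x = x0 or x1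
    and F = f / (X - x), take the forms of F g, of (X - x) g and of F. By the
    Chinese remainder theorem each of them decomposes along coprime factors of
    its modulus, and since f is a square modulo g and g is a square modulo F / P,
    the first minus the other two is concentrated at x, y0 and y1
    (residue_decomposition). The difference of the results for x0 and x1 has
    Witt class 0, and it is what remains at y0 and y1: a hermitian form of rank
    4 over E(sqrt b) whose determinant is P(x0) P(x1) up to squares. The
    determinant of a metabolic hermitian form of rank 4 is a norm (form4_det).

    Witt classes are never formed. Each cancellation is an instance of
    lagrangian_reduction: if a nondegenerate form has a Lagrangian and restricts,
    on a subspace, to the pull-back of a form of complementary size, then that
    form has a Lagrangian too. *)

Set Implicit Arguments.
Unset Strict Implicit.
Unset Printing Implicit Defensive.

(** * Lagrangians and reduction of bilinear forms *)

Section LinearAlgebra.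
Variable E : fieldType.

(** Kernels are exported with a membership test and a dimension bound only, so
    that subspaces can be cut out by any function that is provably linear,
    without declaring a structure on it. *)
Lemma kernel_subspace (V T : vectType E) (phi : V -> T) : linear phi ->
  exists K : {vspace V}, (forall x, (x \in K) = (phi x == 0)) /\
    (dim V <= \dim K + dim T)%N.
Proof.
move=> phi_lin.
pose h : {linear V -> T} := HB.pack phi (GRing.isLinear.Build _ _ _ _ phi phi_lin).
exists (lker (linfun h)); split=> [x|]; first by rewrite memv_ker lfunE.
have := limg_ker_dim (linfun h) fullv; rewrite capfv dimvf => <-.
by rewrite leq_add2l (leq_trans (dimvS (subvf _))) // dimvf.
Qed.

Lemma image_subspace (V W : vectType E) (pi : V -> W) (U : {vspace V}) :
  linear pi -> exists L : {vspace W},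
    [/\ forall y, y \in L -> exists2 x, x \in U & y = pi x
      & exists K : {vspace V}, [/\ (forall x, (x \in K) = (pi x == 0)),
          (dim V <= \dim K + dim W)%N
        & (\dim (U :&: K) + \dim L)%N = \dim U]].
Proof.
move=> pi_lin.
pose h : {linear V -> W} := HB.pack pi (GRing.isLinear.Build _ _ _ _ pi pi_lin).
exists (linfun h @: U)%VS; split.
  by move=> y /memv_imgP [x xU ->]; exists x; rewrite ?lfunE.
exists (lker (linfun h)); split=> [x||]; first by rewrite memv_ker lfunE.
  have := limg_ker_dim (linfun h) fullv; rewrite capfv dimvf => <-.
  by rewrite leq_add2l (leq_trans (dimvS (subvf _))) // dimvf.
exact: limg_ker_dim.
Qed.

Variables (V : vectType E) (B : V -> V -> E).
Hypothesis Blin : forall x, scalar (B x).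
Hypothesis Bsym : forall x y, B x y = B y x.

Lemma orthogonal_subspace (N : {vspace V}) : exists O : {vspace V},
  (forall x, x \in O <-> forall y, y \in N -> B x y = 0) /\
  (dim V <= \dim O + \dim N)%N.
Proof.
pose phi x : 'rV[E]_(\dim N) := \row_i B x (vbasis N)`_i.
have phi_lin : linear phi.
  by move=> a x y; apply/rowP => i; rewrite !mxE ![B _ (vbasis N)`_i]Bsym Blin.
have [O [memO dimO]] := kernel_subspace phi_lin.
exists O; split=> [x|]; last by move: dimO; rewrite [X in (_ + X)%N]dim_matrix mul1r.
rewrite memO; split=> [/eqP phi0 y yN|B0].
  rewrite (coord_vbasis yN).
  have -> : B x (\sum_i coord (vbasis N) i y *: (vbasis N)`_i) =
            \sum_i coord (vbasis N) i y * B x (vbasis N)`_i.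
    pose h : {scalar V} := HB.pack (B x) (GRing.isLinear.Build _ _ _ _ (B x) (Blin x)).
    by rewrite -[B x _]/(h _) linear_sum; apply: eq_bigr => i _; rewrite linearZ.
  by apply: big1 => i _; move/rowP/(_ i): phi0; rewrite !mxE => ->; rewrite mulr0.
apply/eqP/rowP => i; rewrite !mxE; apply: B0; apply: vbasis_mem.
by apply: mem_nth; rewrite size_tuple.
Qed.

Hypothesis Bnondeg : forall x, (forall y, B x y = 0) -> x = 0.

Lemma form_addr x y z : B x (y + z) = B x y + B x z.
Proof. by have := Blin x 1 y z; rewrite scale1r mul1r. Qed.

(** A complement of N has an orthogonal O' of dimension at least \dim N, and O
    meets O' only in 0, since a common vector is orthogonal to N and to its
    complement, hence to everything. *)
Lemma dim_orthogonal (N O : {vspace V}) :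
  (forall x y, x \in O -> y \in N -> B x y = 0) -> (\dim O + \dim N <= dim V)%N.
Proof.
move=> ON; have [O' [memO' dimO']] := orthogonal_subspace N^C.
have OO' : (O :&: O' = 0)%VS.
  apply/eqP; rewrite -subv0; apply/subvP => x /memv_capP [xO /memO' xO'].
  rewrite memv0; apply/eqP/Bnondeg => y.
  have : y \in (N + N^C)%VS by rewrite addv_complf memvf.
  by case/memv_addP => u uN [v vN ->]; rewrite form_addr ON // xO' // addr0.
have := dimv_sum_cap O O'; rewrite OO' dimv0 addn0.
have := dimvS (subvf (O + O')); rewrite dimvf.
rewrite dimv_compl dimvf in dimO'.
have := dimvS (subvf N); rewrite dimvf; lia.
Qed.

(** Lagrangian reduction, the form of Witt cancellation used throughout. Let S
    be the kernel of phi, and K the kernel of pi on S. Then S and K are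
    orthogonal, and counting dimensions against the nondegeneracy of B gives
    S = K^perp, so S / K is nondegenerate and embeds in W; the image in S / K of
    a Lagrangian M is again Lagrangian. The
    equation between the three dimensions forces phi to be surjective, and pi to
    map S onto W. *)
Lemma lagrangian_reduction (T W : vectType E) (C : W -> W -> E)
    (phi : V -> T) (pi : V -> W) (M : {vspace V}) :
  linear phi -> linear pi -> (dim V = (dim T).*2 + dim W)%N ->
  (forall x y, phi x = 0 -> phi y = 0 -> B x y = C (pi x) (pi y)) ->
  (forall u, C 0 u = 0) ->
  (forall x y, x \in M -> y \in M -> B x y = 0) -> (dim V <= (\dim M).*2)%N ->
  exists U : {vspace W},
    (forall u v, u \in U -> v \in U -> C u v = 0) /\ (dim W <= (\dim U).*2)%N.
Proof.
move=> phi_lin pi_lin dimV BC C0 Miso dimM.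
have [S [memS dimS]] := kernel_subspace phi_lin.
have [O [memO dimO]] := orthogonal_subspace M.
have OM : (O <= M)%VS.
  have MO : (M <= O)%VS by apply/subvP => x xM; apply/memO => y yM; apply: Miso.
  have dOM : (\dim O + \dim M <= dim V)%N.
    by apply: dim_orthogonal => x y /memO; apply.
  have : (\dim O <= \dim M)%N by move: dimO dOM dimM; lia.
  move=> dOM'; have : M == O by rewrite eqEdim MO.
  by move/eqP => ->.
have [L [memL [K [memK dimK dimL]]]] := image_subspace (M :&: S)%VS pi_lin.
have SK_S x y : x \in S -> y \in (S :&: K)%VS -> B x y = 0.
  rewrite memS => /eqP x0 /memv_capP []; rewrite memS memK => /eqP y0 /eqP ky.
  by rewrite Bsym BC // ky C0.
have dSK : (\dim S + \dim (S :&: K) <= dim V)%N by apply: dim_orthogonal.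
exists L; split.
  move=> u v /memL [x /memv_capP [xM]]; rewrite memS => /eqP x0 ->.
  move=> /memL [y /memv_capP [yM]]; rewrite memS => /eqP y0 ->.
  by rewrite -BC // Miso.
(* S is the whole orthogonal of K. *)
have dSK2 : (dim V <= \dim S + \dim (S :&: K))%N.
  have := dimv_sum_cap S K; have := dimvS (subvf (S + K)); rewrite dimvf.
  move: dimS dimK dimV; lia.
have dMM : (\dim M + \dim M <= dim V)%N by apply: dim_orthogonal.
(* (M + K)^perp lies in M :&: S, which bounds the dimension of the image. *)
have [P [memP dimP]] := orthogonal_subspace (M + (S :&: K)).
have PMS : (P <= M :&: S)%VS.
  rewrite subv_cap; apply/andP; split.
    apply: subv_trans OM; apply/subvP => x /memP xP; apply/memO => y yM.
    by apply: xP; apply: (subvP (addvSl _ _)).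
  have [Q [memQ dimQ]] := orthogonal_subspace (S :&: K).
  have SQ : (S <= Q)%VS by apply/subvP => x xS; apply/memQ => y; apply: SK_S.
  have dQ : (\dim Q + \dim (S :&: K) <= dim V)%N.
    by apply: dim_orthogonal => x y /memQ; apply.
  have /eqP -> : S == Q by rewrite eqEdim SQ; move: dSK2 dQ; lia.
  apply/subvP => x /memP xP; apply/memQ => y yK.
  by apply: xP; apply: (subvP (addvSr _ _)).
have := dimvS PMS; have := dimv_sum_cap M (S :&: K).
rewrite capvA in dimL *; move: dimP dMM dimL dSK dimS dimV; lia.
Qed.

End LinearAlgebra.

(** * Hermitian forms over a quadratic extension *)

Section NormForm.
Variables (E : fieldType) (b : E).
Hypothesis b_nonsq : forall u v : E, u ^+ 2 - b * v ^+ 2 = 0 -> u = 0 /\ v = 0.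

(** The quadratic extension of E by a square root of b; the pair (u, v) stands
    for u + v sqrt b. *)
Definition quadext : vectType E := (E^o * E^o)%type.

Lemma regular_scaleE (x y : E) : x *: (y : E^o) = x * y. Proof. by []. Qed.

(** The polar form of the norm, the real part of the conjugate of u times v. *)
Definition norm_polar (u v : quadext) : E := (u.1 : E) * v.1 - b * u.2 * v.2.
Definition quad_mul (u v : quadext) : quadext :=
  ((u.1 : E) * v.1 + b * u.2 * v.2, (u.1 : E) * v.2 + (u.2 : E) * v.1).

(** The conjugate of u, times v. *)
Definition quad_conj_mul (u v : quadext) : quadext :=
  ((u.1 : E) * v.1 - b * u.2 * v.2, (u.1 : E) * v.2 - (u.2 : E) * v.1).

Definition quad_scale (x : E) (u : quadext) : quadext := (x * u.1, x * u.2).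

Lemma norm_polar_aniso u : norm_polar u u = 0 -> u = 0.
Proof.
case: u => u1 u2; rewrite /norm_polar /= => e.
by have [|-> ->] := b_nonsq (u := u1) (v := u2); first by rewrite -e; ring.
Qed.

Lemma norm_polar_eq0 u : (norm_polar u u == 0) = (u == 0).
Proof.
apply/eqP/eqP => [|->]; first exact: norm_polar_aniso.
by rewrite /norm_polar /= !mulr0 subr0.
Qed.

Lemma normM (u v : quadext) :
  norm_polar (quad_mul u v) (quad_mul u v) = norm_polar u u * norm_polar v v.
Proof. by rewrite /norm_polar /quad_mul /=; ring. Qed.

Lemma norm_polar_scale_cmul (x : E) (u s t : quadext) :
  norm_polar (quad_scale x (quad_conj_mul u s)) (quad_scale x (quad_conj_mul u t)) =
  x ^+ 2 * norm_polar u u * norm_polar s t.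
Proof. by rewrite /norm_polar /quad_scale /quad_conj_mul /=; ring. Qed.

(** Lagrange's identity, which diagonalises the rank 2 hermitian form <x, y>
    along the vector (u, v) and the direction orthogonal to it. *)
Lemma norm_lagrange (x y : E) (u v s t s' t' : quadext) :
  let h s t := quad_scale x (quad_conj_mul u s) + quad_scale y (quad_conj_mul v t) in
  let d s t := quad_mul u t - quad_mul v s in
  norm_polar (h s t) (h s' t') + x * y * norm_polar (d s t) (d s' t') =
  (x * norm_polar u u + y * norm_polar v v) * (x * norm_polar s s' + y * norm_polar t t').
Proof. by rewrite /norm_polar /quad_scale /quad_conj_mul /quad_mul /=; ring. Qed.

Lemma norm_quotient (x y : E) u v : x * norm_polar u u = y * norm_polar v v -> u != 0 ->
  exists s t : E, x * y = s ^+ 2 - b * t ^+ 2.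
Proof.
move=> e u0; have n0 : norm_polar u u != 0 by rewrite norm_polar_eq0.
pose w := quad_mul u v; pose k := y / norm_polar u u.
exists (k * w.1), (k * w.2).
have -> : x = y * norm_polar v v / norm_polar u u by rewrite -e mulfK.
have -> : (k * w.1) ^+ 2 - b * (k * w.2) ^+ 2
  = k ^+ 2 * (norm_polar u u * norm_polar v v).
  by rewrite -normM /norm_polar -/w; ring.
by rewrite /k; field.
Qed.

Definition norm2 : vectType E := (quadext * quadext)%type.
Definition norm4 : vectType E := (norm2 * norm2)%type.

Definition form4 (x1 x2 x3 x4 : E) (v w : norm4) : E :=
  x1 * norm_polar v.1.1 w.1.1 + x2 * norm_polar v.1.2 w.1.2 +
  (x3 * norm_polar v.2.1 w.2.1 + x4 * norm_polar v.2.2 w.2.2).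

Definition form2 (x1 x2 : E) (v w : norm2) : E :=
  x1 * norm_polar v.1 w.1 + x2 * norm_polar v.2 w.2.

Lemma form2_0l (x1 x2 : E) (u : norm2) : form2 x1 x2 0 u = 0.
Proof. by rewrite /form2 /norm_polar /= !(mulr0, mul0r, subr0, addr0). Qed.

Lemma form4_scalar x1 x2 x3 x4 (v : norm4) : scalar (form4 x1 x2 x3 x4 v).
Proof.
move: v => [[[v1 v1'] [v2 v2']] [[v3 v3'] [v4 v4']]] a.
move=> [[[s1 s1'] [s2 s2']] [[s3 s3'] [s4 s4']]].
move=> [[[t1 t1'] [t2 t2']] [[t3 t3'] [t4 t4']]].
rewrite /form4 /norm_polar /= /GRing.scale /=; ring.
Qed.

Lemma form4_sym x1 x2 x3 x4 (v w : norm4) : form4 x1 x2 x3 x4 v w = form4 x1 x2 x3 x4 w v.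
Proof. by rewrite /form4 /norm_polar; ring. Qed.

Lemma form4_nondeg (x1 x2 x3 x4 : E) (v : norm4) :
  x1 != 0 -> x2 != 0 -> x3 != 0 -> x4 != 0 ->
  (forall w, form4 x1 x2 x3 x4 v w = 0) -> v = 0.
Proof.
move=> x10 x20 x30 x40 v0.
have cut (x : E) u : x != 0 -> x * norm_polar u u = 0 -> u = 0.
  by move=> x0 /eqP; rewrite mulf_eq0 (negPf x0) => /eqP /norm_polar_aniso.
case: v v0 => [[v1 v2] [v3 v4]] v0.
have -> : v1 = 0.
  by apply: (cut x1) => //; rewrite -(v0 (v1, 0, (0, 0))) /form4 /norm_polar /=; ring.
have -> : v2 = 0.
  by apply: (cut x2) => //; rewrite -(v0 (0, v2, (0, 0))) /form4 /norm_polar /=; ring.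
have -> : v3 = 0.
  by apply: (cut x3) => //; rewrite -(v0 (0, 0, (v3, 0))) /form4 /norm_polar /=; ring.
have -> : v4 = 0.
  by apply: (cut x4) => //; rewrite -(v0 (0, 0, (0, v4))) /form4 /norm_polar /=; ring.
by [].
Qed.

Lemma form2_isotropic (y1 y2 : E) (U : {vspace norm2}) :
  y1 != 0 -> y2 != 0 ->
  (forall s t, s \in U -> t \in U -> form2 y1 y2 s t = 0) ->
  (0 < \dim U)%N ->
  exists u v, [/\ u != 0, v != 0 & y1 * norm_polar u u = - y2 * norm_polar v v].
Proof.
move=> y10 y20 Uiso; rewrite lt0n dimv_eq0 -vpick0.
have := Uiso _ _ (memv_pick U) (memv_pick U).
case: (vpick U) => u v; rewrite /form2 /= => uv0 nz.
have e : y1 * norm_polar u u = - y2 * norm_polar v v.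
  by apply/eqP; rewrite mulNr -addr_eq0 uv0.
exists u, v; split=> //; apply: contraNneq nz => z0; move/eqP: e; rewrite z0.
  rewrite /(norm_polar 0) /= !mulr0 subr0 mulr0 eq_sym mulf_eq0 oppr_eq0 (negPf y20)
    norm_polar_eq0 /=.
  by move/eqP => ->.
rewrite {2}/norm_polar /= !mulr0 subr0 mulr0 mulf_eq0 (negPf y10) norm_polar_eq0 /=.
by move/eqP => ->.
Qed.

(** The determinant of a metabolic hermitian form of rank 4 is a norm. An
    isotropic vector v lets the form be reduced to one of rank 2 with the same
    determinant up to sign and norms; that form is again metabolic, hence isotropic, and
    for a binary hermitian form isotropy means that minus the determinant is a
    norm. Since U has dimension 4, v can be chosen with first coordinate 0, which
    leaves only two cases: the second coordinate is nonzero, or v lies in the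
    last two coordinates. *)
Lemma form4_det (x1 x2 x3 x4 : E) (U : {vspace norm4}) :
  x1 != 0 -> x2 != 0 -> x3 != 0 -> x4 != 0 ->
  (forall s t, s \in U -> t \in U -> form4 x1 x2 x3 x4 s t = 0) ->
  (dim norm4 <= (\dim U).*2)%N ->
  exists s t : E, (x1 * x2) * (x3 * x4) = s ^+ 2 - b * t ^+ 2.
Proof.
move=> x10 x20 x30 x40 Uiso dimU.
have Flin := form4_scalar x1 x2 x3 x4; have Fsym := form4_sym x1 x2 x3 x4.
have Fnd v := @form4_nondeg x1 x2 x3 x4 v x10 x20 x30 x40.
have [v [vU v0 v11]] : exists v, [/\ v \in U, v != 0 & v.1.1 = 0].
  have [|K [memK dimK]] := @kernel_subspace E norm4 quadext (fun w => w.1.1).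
    by move=> a [[? ?] ?] [[? ?] ?].
  have : (U :&: K)%VS != 0%VS.
    rewrite -dimv_eq0; have := dimv_sum_cap U K.
    have := dimvS (subvf (U + K)); rewrite dimvf.
    change (dim quadext) with 2%N in dimK.
    by move: dimU dimK; change (dim norm4) with 8%N; lia.
  rewrite -vpick0 => nz; exists (vpick (U :&: K)); split=> //.
    exact: (subvP (capvSl _ _)) (memv_pick _).
  by apply/eqP; rewrite -memK; exact: (subvP (capvSr _ _)) (memv_pick _).
case: v vU v0 v11 => [[v1 v2] [v3 v4]] vU v0 /= v10; subst v1.
move: v0; have := Uiso _ _ vU vU.
have [-> viso v34|v20 viso _] := eqVneq v2 0.
  (* The line of v is a Lagrangian of <x3, x4>, which therefore splits off. *)
  have e34 : x3 * norm_polar v3 v3 = - x4 * norm_polar v4 v4.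
    rewrite /form4 /= {1 2}/norm_polar /= !(mul0r, mulr0, subr0, oppr0, add0r) in viso.
    by apply/eqP; rewrite mulNr -addr_eq0 viso.
  have v30 : v3 != 0.
    apply: contraNneq v34 => v30; move/eqP: e34; rewrite v30.
    rewrite {1}/norm_polar /= !mulr0 subr0 mulr0 eq_sym mulf_eq0 oppr_eq0 (negPf x40)
      norm_polar_eq0 /=.
    by move/eqP => ->.
  have n40 : norm_polar v4 v4 != 0.
    have : x3 * norm_polar v3 v3 != 0 by rewrite mulf_neq0 // norm_polar_eq0.
    by rewrite e34 mulf_eq0 negb_or => /andP[].
  pose phi (w : norm4) : quadext := quad_scale x3 (quad_conj_mul v3 w.2.1)
    + quad_scale x4 (quad_conj_mul v4 w.2.2).
  have [|||||W [Wiso dimW]] :=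
    lagrangian_reduction Flin Fsym Fnd (phi := phi)
      (pi := fun w : norm4 => w.1) (C := form2 x1 x2) (M := U) _ _ _ _ _ Uiso dimU => //.
  - move=> a [[w1 w2] [[w3 w3'] [w4 w4']]] [[u1 u2] [[u3 u3'] [u4 u4']]].
    by rewrite /phi /quad_scale /quad_conj_mul /=; congr (_, _);
      rewrite /= ?regular_scaleE /=; ring.
  - move=> w w' pw pw'; rewrite /form4 /form2.
    suff -> : x3 * norm_polar w.2.1 w'.2.1 + x4 * norm_polar w.2.2 w'.2.2
      = 0 by rewrite addr0.
    have k (s : norm4) : phi s = 0 -> quad_scale x4 (quad_conj_mul v4 s.2.2)
      = quad_scale (- x3) (quad_conj_mul v3 s.2.1).
      by move=> /eqP; rewrite /phi addrC addr_eq0 => /eqP ->; rewrite /quad_scale /=;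
        congr (_, _); rewrite /= mulNr.
    have {}k s t (ps : phi s = 0) (pt : phi t = 0) :
      norm_polar (quad_scale x4 (quad_conj_mul v4 s.2.2)) (quad_scale x4 (quad_conj_mul
        v4 t.2.2)) =
      norm_polar (quad_scale (- x3) (quad_conj_mul v3 s.2.1)) (quad_scale (- x3)
        (quad_conj_mul v3 t.2.1)) by rewrite !k.
    apply: (mulfI (mulf_neq0 x40 n40)); rewrite mulr0.
    have := k _ _ pw pw'; rewrite !norm_polar_scale_cmul sqrrN => {}k.
    transitivity (x3 * norm_polar w.2.1 w'.2.1 * (x4 * norm_polar v4 v4)
                  + x4 ^+ 2 * norm_polar v4 v4 * norm_polar w.2.2 w'.2.2); first by ring.
    rewrite k; transitivity
      (x3 * norm_polar w.2.1 w'.2.1 * (x4 * norm_polar v4 v4 + x3 * norm_polar v3 v3));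
        first by ring.
    by rewrite e34; ring.
  - exact: form2_0l.
  have [|s [t [s0 t0 est]]] := form2_isotropic x10 x20 Wiso.
    by move: dimW; change (dim norm2) with 4%N; lia.
  have [||p [q e]] := @norm_quotient (x1 * x3) (x2 * x4) (quad_mul s v3) (quad_mul t v4).
  - rewrite !normM; transitivity ((x1 * norm_polar s s) * (x3 * norm_polar v3 v3));
    first by ring.
    by rewrite est e34; ring.
  - by rewrite -norm_polar_eq0 normM mulf_neq0 // norm_polar_eq0.
  by exists p, q; rewrite -e; ring.
have n20 : norm_polar v2 v2 != 0 by rewrite norm_polar_eq0.
(* Here <x3, x4> represents - z, so it is <- z, - x3 x4 / z>, and z cancels
   against the second coordinate. *)
pose z := x2 * norm_polar v2 v2; have z0 : z != 0 by rewrite mulf_neq0.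
pose phi (w : norm4) : quadext :=
  quad_scale x2 (quad_conj_mul v2 w.1.2) + (quad_scale x3 (quad_conj_mul v3 w.2.1)
    + quad_scale x4 (quad_conj_mul v4 w.2.2)).
pose pi (w : norm4) : norm2 := (w.1.1, quad_mul v3 w.2.2 - quad_mul v4 w.2.1).
have e34 : x4 * norm_polar v4 v4 = - z - x3 * norm_polar v3 v3.
  have zz : z + (x3 * norm_polar v3 v3 + x4 * norm_polar v4 v4) = 0.
    rewrite -viso /form4 -/z /=; congr (_ + _).
    by rewrite {1}/norm_polar /= !(mulr0, mul0r, oppr0, subr0, add0r).
  by rewrite -[LHS]subr0 -zz; ring.
have [|||||W [Wiso dimW]] :=
  lagrangian_reduction Flin Fsym Fnd (phi := phi) (pi := pi)
    (C := form2 x1 (- (x3 * x4 / z))) (M := U) _ _ _ _ _ Uiso dimU => //.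
- move=> a [[w1 w2] [[w3 w3'] [w4 w4']]] [[u1 [u2 u2']] [[u3 u3'] [u4 u4']]].
  by rewrite /phi /quad_scale /quad_conj_mul /=; congr (_, _);
    rewrite /= ?regular_scaleE /=; ring.
- move=> a [[w1 w2] [[w3 w3'] [w4 w4']]] [[u1 [u2 u2']] [[u3 u3'] [u4 u4']]].
  by rewrite /pi /quad_mul /=; congr (_, (_, _)); rewrite /= ?regular_scaleE /=; ring.
- move=> w w' pw pw'; rewrite /form4 /form2 /= -addrA; congr (_ + _).
  pose h34 (s : norm4) := quad_scale x3 (quad_conj_mul v3 s.2.1)
    + quad_scale x4 (quad_conj_mul v4 s.2.2).
  have k (s : norm4) : phi s = 0 -> quad_scale x2 (quad_conj_mul v2 s.1.2) = - h34 s.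
    by move=> /eqP; rewrite /phi addr_eq0 => /eqP.
  have {}k s t (ps : phi s = 0) (pt : phi t = 0) :
      z * (x2 * norm_polar s.1.2 t.1.2) = norm_polar (h34 s) (h34 t).
    transitivity (norm_polar (- h34 s) (- h34 t)); last by rewrite /norm_polar /=; ring.
    by rewrite -!k // norm_polar_scale_cmul /z; ring.
  have L := norm_lagrange x3 x4 v3 v4 w.2.1 w.2.2 w'.2.1 w'.2.2.
  apply: (mulfI z0); rewrite mulrDr k //; rewrite /= -/(h34 w) -/(h34 w') e34 in L.
  have zc : z * - (x3 * x4 / z) = - (x3 * x4) by field.
  rewrite [RHS]mulrA zc mulNr.
  rewrite -[norm_polar (h34 w) _](addrK (x3 * x4 * norm_polar (pi w).2 (pi w').2)) L.
  by rewrite /pi /=; ring.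
- exact: form2_0l.
have [| |s [t [s0 t0 est]]] := form2_isotropic x10 _ Wiso.
- by rewrite oppr_eq0 !mulf_neq0 // invr_eq0.
- by move: dimW; change (dim norm2) with 4%N; lia.
have [||p [q e]] := @norm_quotient (x1 * x2) (x3 * x4) (quad_mul s v2) t.
- transitivity (x1 * norm_polar s s * z); first by rewrite normM /z; ring.
  by rewrite est; field.
- by rewrite -norm_polar_eq0 normM mulf_neq0 // norm_polar_eq0.
by exists p, q.
Qed.

End NormForm.

(** The size of a polynomial is generalised up to conversion first: several
    structure paths to its type occur, and lia would take them for distinct
    atoms. *)
Ltac size_lia :=
  repeat match goal with
  | |- context [size (polyseq ?p)] =>
      let n := fresh "n" in set n := size (polyseq p); clearbody n
  end; lia.

(** * The residue form on E[X]/(G) *)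

Lemma horner1 (E : fieldType) (x : E) : (1 : {poly E}).[x] = 1.
Proof. by rewrite -polyC1 hornerC. Qed.

Definition evalE := (horner1, hornerXsubC, hornerD, hornerN, hornerZ, hornerM).

Section Residues.
Variable E : fieldType.
Implicit Types G h k p q r : {poly E}.

(** The sum of the residues of (h / G) dX at the zeros of G, that is, minus its
    residue at infinity. The symmetric form (p, q) |-> residue_sum G (p * q) on
    E[X]/(G) is the transfer of the unit form. *)
Definition residue_sum G h : E := (h %% G)`_(size G).-2 / lead_coef G.

Lemma residue_sum_scalar G : scalar (residue_sum G).
Proof.
move=> a p q; rewrite /residue_sum modpD modpZl coefD coefZ.
by rewrite mulrDl mulrA.
Qed.

Lemma residue_sumB G p q : residue_sum G (p - q) = residue_sum G p - residue_sum G q.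
Proof.
have := residue_sum_scalar G (-1) q p.
by rewrite scaleN1r mulN1r addrC [- _ + _]addrC.
Qed.

Lemma coefM_top m n p q : (size p <= m.+1)%N -> (size q <= n.+1)%N ->
  (p * q)`_(m + n) = p`_m * q`_n.
Proof.
move=> sp sq; rewrite coefM.
have mlt : (m < (m + n).+1)%N by rewrite ltnS leq_addr.
rewrite (bigD1 (Ordinal mlt)) //= addKn big1 ?addr0 // => i ne.
have [lt|ge] := ltnP i m.
  rewrite [q`__]nth_default ?mulr0 // (leq_trans sq) //; lia.
rewrite [p`__]nth_default ?mul0r // (leq_trans sp) //.
by rewrite ltn_neqAle ge andbT eq_sym; apply: contraNneq ne => e; apply/eqP/val_inj.
Qed.

(** A residue sum depends on the fraction h / G only, so two of them can be
    compared over a common denominator. *)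
Lemma residue_sum_mulr G h k : G != 0 -> k != 0 ->
  residue_sum (G * k) (h * k) = residue_sum G h.
Proof.
move=> G0 k0; rewrite /residue_sum lead_coefM.
have sz : (size (h %% G)%R < size G)%N by rewrite ltn_modp.
have -> : (h * k) %% (G * k) = (h %% G) * k.
  rewrite -(@modpP _ (h * k) (h %/ G) (G * k) (h %% G * k)) //.
    by rewrite {1}(divp_eq h G); ring.
  rewrite (size_mul G0 k0); have := size_polyMleq (h %% G)%R k.
  have : (0 < size k)%N by rewrite size_poly_gt0.
  move: sz; size_lia.
have lck : lead_coef k != 0 by rewrite lead_coef_eq0.
have lcG : lead_coef G != 0 by rewrite lead_coef_eq0.
have [s1|s2] := leqP (size G) 1.
  have -> : h %% G = 0.
    by apply/eqP; rewrite -size_poly_eq0; move: sz s1; case: (size _) => //; size_lia.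
  by rewrite mul0r !coef0 !mul0r.
have -> : (size (G * k)).-2 = ((size G).-2 + (size k).-1)%N.
  rewrite size_mul //; have : (0 < size k)%N by rewrite size_poly_gt0.
  by move: s2; size_lia.
rewrite coefM_top ?leqSpred //; last by move: sz s2; size_lia.
by rewrite -[k`__]/(lead_coef k); field; rewrite lck lcG.
Qed.

Lemma residue_sum_linear x h : residue_sum ('X - x%:P) h = h.[x].
Proof.
by rewrite /residue_sum size_XsubC lead_coefXsubC divr1 modp_XsubC coefC.
Qed.

Lemma residue_sum_pole x G h k a : G != 0 -> h = a *: G + k * ('X - x%:P) ->
  residue_sum (G * ('X - x%:P)) h = a + residue_sum G k.
Proof.
move=> G0 ->; rewrite residue_sum_scalar residue_sum_mulr ?polyXsubC_eq0 //.
have X0 : 'X - x%:P != 0 by rewrite polyXsubC_eq0.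
have := @residue_sum_mulr ('X - x%:P) 1 G X0 G0.
by rewrite mul1r mulrC => ->; rewrite residue_sum_linear hornerC mulr1.
Qed.

Lemma residue_sum3 x y z h : x != y -> x != z -> y != z ->
  residue_sum (('X - z%:P) * ('X - y%:P) * ('X - x%:P)) h =
  h.[x] / ((x - y) * (x - z)) + h.[y] / ((y - x) * (y - z)) +
  h.[z] / ((z - x) * (z - y)).
Proof.
move=> xy xz yz.
have xy0 : x - y != 0 by rewrite subr_eq0.
have xz0 : x - z != 0 by rewrite subr_eq0.
have yz0 : y - z != 0 by rewrite subr_eq0.
have yx0 : y - x != 0 by rewrite subr_eq0 eq_sym.
have zx0 : z - x != 0 by rewrite subr_eq0 eq_sym.
have zy0 : z - y != 0 by rewrite subr_eq0 eq_sym.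
have split u G l : G.[u] != 0 -> exists k, l = (l.[u] / G.[u]) *: G + k * ('X - u%:P).
  move=> Gu; have : root (l - (l.[u] / G.[u]) *: G) u.
    by rewrite rootE !evalE divfK ?subrr.
  by case/factor_theorem => k e; exists k; rewrite -e addrC subrK.
have [|k hk] := split x (('X - z%:P) * ('X - y%:P)) h.
  by rewrite !evalE mulf_neq0.
have [|l kl] := split y ('X - z%:P) k; first by rewrite !evalE.
rewrite (residue_sum_pole _ hk) ?mulf_neq0 ?polyXsubC_eq0 //.
rewrite (residue_sum_pole _ kl) ?polyXsubC_eq0 // residue_sum_linear.
have hy : h.[y] = k.[y] * (y - x) by rewrite [in LHS]hk !evalE; ring.
have hz : h.[z] = l.[z] * (z - y) * (z - x).
  by rewrite [in LHS]hk [in LHS]kl !evalE; ring.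
rewrite hy hz !evalE; field.
by rewrite xy0 xz0 yz0 yx0 zx0 zy0.
Qed.

Lemma residue_sum_small G h : (size h < size G)%N ->
  residue_sum G h = h`_(size G).-2 / lead_coef G.
Proof. by move=> sh; rewrite /residue_sum modp_small. Qed.

Lemma residue_sum_nondeg G p : p != 0 -> (size p < size G)%N ->
  exists q, (size q < size G)%N /\ residue_sum G (p * q) != 0.
Proof.
move=> p0 sp; exists ('X^((size G).-2 - (size p).-1)).
have sp0 : (0 < size p)%N by rewrite size_poly_gt0.
have G0 : lead_coef G != 0 by rewrite lead_coef_eq0 -size_poly_gt0; move: sp; size_lia.
rewrite size_polyXn; split; first by move: sp sp0; size_lia.
have e : (size (p * 'X^((size G).-2 - (size p).-1))).-1 = (size G).-2.
  rewrite size_mulXn //; move: sp sp0; size_lia.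
rewrite residue_sum_small; last by rewrite size_mulXn //; move: sp sp0; size_lia.
rewrite mulf_neq0 ?invr_eq0 //; move: e; set q := 'X^_ => <-.
rewrite -lead_coefE lead_coefM lead_coefXn mulr1.
by rewrite lead_coef_eq0.
Qed.

(** The conditions cutting out a Lagrangian of the difference of two residue
    forms of degree d: with P = (p, p'), both p and p' have degree at most
    (d - 1) / 2, and if d is odd then their coefficients in that degree agree. *)
Definition pair_condition (d : nat) (P : {poly E} * {poly E}) : 'rV[E]_d :=
  \row_(j < d) (if (j < d./2)%N then P.1`_(d.-1 - j) else P.1`_j - P.2`_j).

(** The Witt class of the residue form depends only on the degree and the
    leading coefficient of G: polynomials of degree below (d - 1) / 2 are
    orthogonal to those of degree at most (d - 1) / 2, and when d is odd the
    anisotropic part is read off from the middle coefficient. *)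
Lemma pair_lagrangian d G G' (P Q : {poly E} * {poly E}) :
  size G = d.+1 -> size G' = d.+1 -> lead_coef G = lead_coef G' ->
  (size P.1 <= d)%N -> (size P.2 <= d)%N -> (size Q.1 <= d)%N -> (size Q.2 <= d)%N ->
  pair_condition d P = 0 -> pair_condition d Q = 0 ->
  residue_sum G (P.1 * Q.1) = residue_sum G' (P.2 * Q.2).
Proof.
move=> sG sG' lc.
pose e := d./2; have uh := uphalf_half d; have dh := odd_double_half d.
have eh : (e + uphalf d = d)%N by move: uh dh; rewrite /e; lia.
have eu : (e <= uphalf d <= e.+1)%N by rewrite uh /e; case: (odd d); lia.
have sizes (R : {poly E} * {poly E}) : (size R.1 <= d)%N -> (size R.2 <= d)%N ->
    pair_condition d R = 0 ->
    [/\ (size R.1 <= uphalf d)%N, (size (R.1 - R.2)%R <= e)%N & (size R.2 <= uphalf d)%N].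
  move=> s1 s2 /rowP c.
  have c1 i : (uphalf d <= i)%N -> R.1`_i = 0.
    move=> ui; have [id|di] := ltnP i d; last by rewrite nth_default // (leq_trans s1).
    have jd : (d.-1 - i < d)%N by lia.
    have := c (Ordinal jd); rewrite !mxE /= -/e ifT; last by lia.
    by rewrite (_ : (d.-1 - (d.-1 - i) = i)%N) //; lia.
  have c2 i : (e <= i)%N -> R.1`_i - R.2`_i = 0.
    move=> ei; have [id|di] := ltnP i d; last first.
      by rewrite !nth_default ?subrr // (leq_trans _ di).
    by have := c (Ordinal id); rewrite !mxE /= -/e ltnNge ei.
  have s12 : (size (R.1 - R.2)%R <= e)%N.
    by apply/leq_sizeP => i ei; rewrite coefB c2.
  split=> //; first exact/leq_sizeP.
  apply/leq_sizeP => i ui; have := c2 i; rewrite c1 // sub0r => z.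
  by apply/eqP; rewrite -oppr_eq0 z //; move: eu; lia.
move=> P1 P2 Q1 Q2 /(sizes P P1 P2) [p1 p12 p2] /(sizes Q Q1 Q2) [q1 q12 q2].
have sm (u v : {poly E}) m n : (size u <= m)%N -> (size v <= n)%N
  -> (size (u * v)%R <= (m + n).-1)%N.
  by move=> su sv; have := size_polyMleq u v; lia.
have [d0|d0] := posnP d.
  have -> : P.1 = 0 by apply/eqP; rewrite -size_poly_leq0 -d0.
  have -> : P.2 = 0 by apply/eqP; rewrite -size_poly_leq0 -d0.
  by rewrite !mul0r /residue_sum !mod0p !coef0 !mul0r.
rewrite !residue_sum_small ?sG ?sG' ?lc; first last.
- by have := sm _ _ _ _ p1 q1; move: eu eh; lia.
- by have := sm _ _ _ _ p2 q2; move: eu eh; lia.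
congr (_ / _); apply/eqP; rewrite -subr_eq0 -coefB.
have -> : P.1 * Q.1 - P.2 * Q.2 = P.1 * (Q.1 - Q.2) + (P.1 - P.2) * Q.2 by ring.
have s12 : (size (P.1 * (Q.1 - Q.2))%R <= d.-1)%N.
  by have := sm _ _ _ _ p1 q12; rewrite addnC eh.
have s21 : (size ((P.1 - P.2) * Q.2)%R <= d.-1)%N.
  by have := sm _ _ _ _ p12 q2; rewrite eh.
by rewrite coefD !nth_default ?addr0.
Qed.

Section LocalDecomposition.
Variables (b x y0 y1 : E) (g k sigma tau : {poly E}).
Let P := ('X - y0%:P) * ('X - y1%:P).
Let F := P * k.
Hypotheses (xy0 : x != y0) (xy1 : x != y1) (y01 : y0 != y1).
Hypotheses (g_sigma : g %| F * ('X - x%:P) - sigma ^+ 2) (cop_sigma : coprimep g sigma).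
Hypotheses (k_tau : k %| g - tau ^+ 2) (cop_gk : coprimep g k).
Hypotheses (kx : k.[x] != 0) (ky0 : k.[y0] != 0) (ky1 : k.[y1] != 0).
Hypotheses (gx : g.[x] != 0) (gy0 : g.[y0] != 0) (gy1 : g.[y1] != 0).

(** Over the common denominator F g (X - x) the three fractions add up to one
    whose poles at g and at k have disappeared. At g this is because
    F (X - x) is the square of sigma, so that F and X - x agree up to squares; at
    k it is because g is the square of tau. Only the simple poles x, y0 and y1 remain. *)
Lemma residue_decomposition p1 p2 q1 q2 r1 r2 :
  g %| sigma * q1 - ('X - x%:P) * p1 -> g %| sigma * q2 - ('X - x%:P) * p2 ->
  k %| p1 - tau * r1 -> k %| p2 - tau * r2 ->
  residue_sum (F * g) (p1 * p2) - residue_sum (('X - x%:P) * g) (q1 * q2)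
    - residue_sum F (r1 * r2) =
  - (q1.[x] * q2.[x] / g.[x])
  + (p1.[y0] * p2.[y0] / g.[y0] - r1.[y0] * r2.[y0]) / (k.[y0] * (y0 - y1))
  + (p1.[y1] * p2.[y1] / g.[y1] - r1.[y1] * r2.[y1]) / (k.[y1] * (y1 - y0)).
Proof.
move=> gq1 gq2 kr1 kr2; set X := 'X - x%:P.
have nz u (l : {poly E}) : l.[u] != 0 -> l != 0 by apply: contraNneq => ->;
  rewrite horner0.
have g0 := nz _ _ gx; have k0 := nz _ _ kx.
have X0 : X != 0 by rewrite polyXsubC_eq0.
have P0 : P != 0 by rewrite mulf_neq0 ?polyXsubC_eq0.
have F0 : F != 0 by rewrite mulf_neq0.
pose N := X * (p1 * p2) - F * (q1 * q2) - g * X * (r1 * r2).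
have gN : g %| N.
  rewrite /N dvdp_subl ?dvdp_mulr //.
  rewrite -(Gauss_dvdpr _ (coprimep_expr 2 cop_sigma)).
  have -> : sigma ^+ 2 * (X * (p1 * p2) - F * (q1 * q2)) =
     - (X * p1 * p2) * (F * X - sigma ^+ 2)
     - F * sigma * q2 * (sigma * q1 - X * p1)
     - F * X * p1 * (sigma * q2 - X * p2) by ring.
  by do !apply: dvdp_sub; apply: dvdp_mull.
have kN : k %| N.
  have -> : N = X * p2 * (p1 - tau * r1) + X * tau * r1 * (p2 - tau * r2)
      - X * r1 * r2 * (g - tau ^+ 2) - P * q1 * q2 * k by rewrite /N /F; ring.
  by do !(apply: dvdp_sub || apply: dvdp_add); apply: dvdp_mull.
have /dvdpP [N' NN] : g * k %| N by rewrite Gauss_dvdp // gN.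
have -> : residue_sum (F * g) (p1 * p2) = residue_sum (F * g * X) (X * (p1 * p2)).
  by rewrite [X * _]mulrC residue_sum_mulr // mulf_neq0.
have -> : residue_sum (X * g) (q1 * q2) = residue_sum (F * g * X) (F * (q1 * q2)).
  have -> : F * g * X = X * g * F by ring.
  by rewrite [F * _]mulrC residue_sum_mulr // mulf_neq0.
have -> : residue_sum F (r1 * r2) = residue_sum (F * g * X) (g * X * (r1 * r2)).
  have -> : F * g * X = F * (g * X) by ring.
  by rewrite [g * X * (_ * _)]mulrC residue_sum_mulr // mulf_neq0.
rewrite -!residue_sumB -/N NN.
have -> : F * g * X = P * X * (g * k) by rewrite /F; ring.
rewrite residue_sum_mulr ?mulf_neq0 ?polyXsubC_eq0 //.
have -> : P * X = ('X - y1%:P) * ('X - y0%:P) * X by rewrite /P; ring.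
rewrite residue_sum3 //.
have ev u : N'.[u] * (g.[u] * k.[u]) = N.[u] by rewrite NN !evalE.
have evd u : g.[u] != 0 -> k.[u] != 0 -> N'.[u] = N.[u] / (g.[u] * k.[u]).
  by move=> gu ku; rewrite -ev mulfK // mulf_neq0.
rewrite !evd // /N /F /P /X !evalE.
have [a0 a1 a2] : [/\ x - y0 != 0, x - y1 != 0 & y0 - y1 != 0] by rewrite !subr_eq0.
have [b0 b1 b2] : [/\ y0 - x != 0, y1 - x != 0 & y1 - y0 != 0].
  by rewrite !subr_eq0 ![_ == x]eq_sym [y1 == _]eq_sym.
by field; rewrite a0 a1 a2 b0 b1 b2 gx gy0 gy1 kx ky0 ky1.
Qed.

End LocalDecomposition.
End Residues.

(** * The reciprocity law *)

Section Reciprocity.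
Variables (E : fieldType) (b x0 x1 y0 y1 : E) (f2 g sigma tau : {poly E}).
Hypothesis b_nonsq : forall u v : E, u ^+ 2 - b * v ^+ 2 = 0 -> u = 0 /\ v = 0.
Hypotheses (x01 : x0 != x1) (y01 : y0 != y1).
Hypotheses (xy00 : x0 != y0) (xy01 : x0 != y1) (xy10 : x1 != y0) (xy11 : x1 != y1).

Let P := ('X - y0%:P) * ('X - y1%:P).
Let k0 := ('X - x1%:P) * f2.
Let k1 := ('X - x0%:P) * f2.
Let F0 := P * k0.
Let F1 := P * k1.
Let f := P * ('X - x0%:P) * ('X - x1%:P) * f2.

Hypotheses (f2x0 : f2.[x0] != 0) (f2x1 : f2.[x1] != 0).
Hypotheses (f2y0 : f2.[y0] != 0) (f2y1 : f2.[y1] != 0).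
Hypotheses (g_sigma : g %| f - sigma ^+ 2) (cop_fg : coprimep f g).
Hypothesis g_tau : ('X - x0%:P) * ('X - x1%:P) * f2 %| g - tau ^+ 2.
Hypotheses (g_y0 : g.[y0] = b * tau.[y0] ^+ 2) (g_y1 : g.[y1] = b * tau.[y1] ^+ 2).

Variables m n : nat.
Hypotheses (size_g : size g = m.+1) (size_f2 : size f2 = n.+1).

Let polys d : vectType E := ({poly_d E} * {poly_d E})%type.
Let V : vectType E := (polys (n + 3 + m) * polys m.+1 * polys (n + 3))%type.
Let T : vectType E := (polys m * polys n.+1 * E^o)%type.

Lemma npoly_linear d a (u v : {poly_d E}) :
  (a *: u + v : {poly_d E}) = a *: (u : {poly E}) + v :> {poly E}.
Proof. by []. Qed.

Lemma npolyp_mod_linear d h a (p q : {poly E}) :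
  npolyp d ((a *: p + q) %% h) = a *: npolyp d (p %% h) + npolyp d (q %% h).
Proof.
apply/npolyP => i; rewrite npoly_linear coefD coefZ !coef_npolyp modpD modpZl coefD coefZ.
by case: ifP => // _; rewrite mulr0 addr0.
Qed.

(** The orthogonal sum of six residue forms: the three that belong to x0 in
    residue_decomposition, minus the three that belong to x1. *)
Let big_form (v w : V) : E :=
  (residue_sum (F0 * g) ((v.1.1.1 : {poly E}) * w.1.1.1)
    - residue_sum (F1 * g) ((v.1.1.2 : {poly E}) * w.1.1.2))
  - (residue_sum (('X - x0%:P) * g) ((v.1.2.1 : {poly E}) * w.1.2.1)
    - residue_sum (('X - x1%:P) * g) ((v.1.2.2 : {poly E}) * w.1.2.2))
  - (residue_sum F0 ((v.2.1 : {poly E}) * w.2.1)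
    - residue_sum F1 ((v.2.2 : {poly E}) * w.2.2)).

(** The congruences that make the poles at g and at k0, k1 disappear; the last
    component glues the contributions of the poles at x0 and x1, which are
    opposite to each other. *)
Let matching (v : V) : T :=
  (npolyp m ((sigma * v.1.2.1 - ('X - x0%:P) * v.1.1.1) %% g),
   npolyp m ((sigma * v.1.2.2 - ('X - x1%:P) * v.1.1.2) %% g),
   (npolyp n.+1 (((v.1.1.1 : {poly E}) - tau * v.2.1) %% k0),
    npolyp n.+1 (((v.1.1.2 : {poly E}) - tau * v.2.2) %% k1)),
   tau.[x1] * (v.1.2.1 : {poly E}).[x0] - tau.[x0] * (v.1.2.2 : {poly E}).[x1]).

(** The values that carry the remaining residues, at y0 and y1, scaled so that
    the residues become norms from E(sqrt b). *)
Let boundary (v : V) : norm4 E :=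
  (((v.2.1 : {poly E}).[y0], (v.1.1.1 : {poly E}).[y0] / (b * tau.[y0])),
   ((v.2.1 : {poly E}).[y1], (v.1.1.1 : {poly E}).[y1] / (b * tau.[y1])),
  (((v.2.2 : {poly E}).[y0], (v.1.1.2 : {poly E}).[y0] / (b * tau.[y0])),
   ((v.2.2 : {poly E}).[y1], (v.1.1.2 : {poly E}).[y1] / (b * tau.[y1])))).

Lemma big_form_scalar v : scalar (big_form v).
Proof.
have e := residue_sum_scalar.
have d G a (p q r : {poly E}) : residue_sum G (p * (a *: q + r))
  = a * residue_sum G (p * q) + residue_sum G (p * r).
  by rewrite -e mulrDr scalerAr.
move: v => [[[? ?] [? ?]] [? ?]] a [[[? ?] [? ?]] [? ?]] [[[? ?] [? ?]] [? ?]].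
rewrite /big_form /= !d; ring.
Qed.

Lemma big_form_sym v w : big_form v w = big_form w v.
Proof.
have s G (p q : {poly E}) : residue_sum G (p * q)
  = residue_sum G (q * p) by rewrite mulrC.
by rewrite /big_form; congr (_ - _ - _); congr (_ - _); exact: s.
Qed.

Lemma matching_linear : linear matching.
Proof.
have d h k (p q u v : {poly E}) a : h * (a *: p + u) - k * (a *: q + v) =
   a *: (h * p - k * q) + (h * u - k * v).
  by rewrite scalerBr !mulrDr !scalerAr; ring.
have d1 h (p q u v : {poly E}) a : (a *: p + u) - h * (a *: q + v) =
   a *: (p - h * q) + (u - h * v).
  by rewrite scalerBr mulrDr !scalerAr; ring.
move=> a [[[? ?] [? ?]] [? ?]] [[[? ?] [? ?]] [? ?]].
rewrite /matching /=; congr (_, _, (_, _), _); rewrite /= ?d ?d1 ?npolyp_mod_linear //.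
by rewrite !evalE regular_scaleE; ring.
Qed.

Lemma boundary_linear : linear boundary.
Proof.
move=> a [[[? ?] [? ?]] [? ?]] [[[? ?] [? ?]] [? ?]].
by rewrite /boundary /=; congr (_, _, (_, _), ((_, _), (_, _)));
  rewrite /= !evalE ?regular_scaleE; ring.
Qed.

Lemma nonzero_of_eval u (l : {poly E}) : l.[u] != 0 -> l != 0.
Proof. by apply: contraNneq => ->; rewrite horner0. Qed.

Lemma g_eval_neq0 z : z \in [:: x0; x1; y0; y1] -> g.[z] != 0.
Proof.
move=> zin; apply: (coprimep_root cop_fg).
rewrite /f /P !rootM !root_XsubC; move: zin; rewrite !inE.
by case/or4P => /eqP ->; rewrite eqxx ?orbT.
Qed.

Lemma cop_g_sigma : coprimep g sigma.
Proof.
rewrite -(@coprimep_pexpr _ 2) // -coprimep_modr.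
have -> : sigma ^+ 2 %% g = f %% g.
  by apply/eqP; rewrite eq_sym -subr_eq0 -modpN -modpD -/(g %| _).
by rewrite coprimep_modr coprimep_sym.
Qed.

Lemma g_neq0 : g != 0.
Proof. by apply: (@nonzero_of_eval x0); rewrite g_eval_neq0 // !inE eqxx. Qed.

Lemma f2_neq0 : f2 != 0. Proof. exact: nonzero_of_eval f2x0. Qed.

Lemma size_XsubC_mul x (l : {poly E}) : l != 0 -> size (('X - x%:P) * l) = (size l).+1.
Proof. by move=> l0; rewrite size_mul ?polyXsubC_eq0 // size_XsubC. Qed.

Lemma size_F x : size (P * (('X - x%:P) * f2)) = (n + 3).+1.
Proof.
rewrite /P -mulrA !size_XsubC_mul ?mulf_neq0 ?polyXsubC_eq0 ?f2_neq0 // size_f2.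
by rewrite addn3.
Qed.

Lemma F_neq0 x : P * (('X - x%:P) * f2) != 0.
Proof. by rewrite -size_poly_gt0 size_F. Qed.

Lemma lead_coef_F x : lead_coef (P * (('X - x%:P) * f2)) = lead_coef f2.
Proof. by rewrite !lead_coefM !lead_coefXsubC !mul1r. Qed.

Lemma size_Fg x : size (P * (('X - x%:P) * f2) * g) = (n + 3 + m).+1.
Proof. by rewrite size_mul ?F_neq0 ?g_neq0 // size_F size_g addnS. Qed.

Lemma big_form_nondeg v : (forall w, big_form v w = 0) -> v = 0.
Proof.
have key (G : {poly E}) d (p : {poly_d E}) : size G = d.+1 ->
    (forall q : {poly_d E}, residue_sum G ((p : {poly E}) * q) = 0) -> p = 0.
  move=> sG h; apply/val_inj/eqP; apply/negP => /negP p0.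
  have sp : (size p < size G)%N by rewrite sG ltnS size_npoly.
  have [q [sq]] := residue_sum_nondeg p0 sp.
  rewrite sG ltnS in sq.
  by have := h (npolyp d q); rewrite npolypK // => ->; rewrite eqxx.
have z G (p : {poly E}) : residue_sum G (p * 0) = 0.
  by rewrite mulr0 /residue_sum mod0p coef0 mul0r.
case: v => [[[p p'] [q q']] [r r']] Bv.
have -> : p = 0.
  apply: (key (F0 * g)) => [|s]; first exact: size_Fg.
  by rewrite -(Bv (s, 0, (0, 0), (0, 0))) /big_form /= !z; ring.
have -> : p' = 0.
  apply: (key (F1 * g)) => [|s]; first exact: size_Fg.
  by apply/eqP; rewrite -oppr_eq0 -(Bv (0, s, (0, 0), (0, 0))) /big_form /= !z;
    apply/eqP; ring.
have -> : q = 0.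
  apply: (key (('X - x0%:P) * g)) => [|s]; first by rewrite size_XsubC_mul ?g_neq0 //
    size_g.
  by apply/eqP; rewrite -oppr_eq0 -(Bv (0, 0, (s, 0), (0, 0))) /big_form /= !z;
    apply/eqP; ring.
have -> : q' = 0.
  apply: (key (('X - x1%:P) * g)) => [|s]; first by rewrite size_XsubC_mul ?g_neq0 //
    size_g.
  by rewrite -(Bv (0, 0, (0, s), (0, 0))) /big_form /= !z; ring.
have -> : r = 0.
  apply: (key F0) => [|s]; first exact: size_F.
  by apply/eqP; rewrite -oppr_eq0 -(Bv (0, 0, (0, 0), (s, 0))) /big_form /= !z;
    apply/eqP; ring.
have -> : r' = 0.
  apply: (key F1) => [|s]; first exact: size_F.
  by rewrite -(Bv (0, 0, (0, 0), (0, s))) /big_form /= !z; ring.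
by [].
Qed.

(** The six forms come in three pairs with moduli of equal degree and leading
    coefficient, and each pair is metabolic by pair_lagrangian. *)
Lemma big_form_lagrangian : exists M : {vspace V},
  (forall v w, v \in M -> w \in M -> big_form v w = 0) /\ (dim V <= (\dim M).*2)%N.
Proof.
pose W : vectType E := ('rV[E]_(n + 3 + m) * 'rV[E]_m.+1 * 'rV[E]_(n + 3))%type.
pose to_pair d (u : polys d) : {poly E} * {poly E} := (polyn u.1, polyn u.2).
pose psi (v : V) : W :=
  (pair_condition (n + 3 + m) (to_pair _ v.1.1), pair_condition m.+1 (to_pair _ v.1.2),
   pair_condition (n + 3) (to_pair _ v.2)).
have psi_lin : linear psi.
  have coef d a (u v : polys d) : pair_condition d (to_pair _ (a *: u + v)) =
      a *: pair_condition d (to_pair _ u) + pair_condition d (to_pair _ v).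
    case: u v => [u u'] [v v']; apply/rowP => j; rewrite !mxE /=.
    by case: ifP => _; rewrite !coefD !coefZ; ring.
  by move=> a [[u1 u2] u3] [[v1 v2] v3]; rewrite /psi /=; congr (_, _, _); exact: coef.
have [M [memM dimM]] := kernel_subspace psi_lin.
exists M; split.
  have z d (G G' : {poly E}) (u v : polys d) : size G = d.+1 -> size G' = d.+1 ->
      lead_coef G = lead_coef G' ->
      pair_condition d (to_pair _ u) = 0 -> pair_condition d (to_pair _ v) = 0 ->
      residue_sum G ((u.1 : {poly E}) * v.1) - residue_sum G' ((u.2 : {poly E}) * v.2)
        = 0.
    move=> sG sG' lc u0 v0; apply/eqP; rewrite subr_eq0; apply/eqP.
    by apply: (pair_lagrangian sG sG' lc _ _ _ _ u0 v0); exact: size_npoly.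
  move=> [[v1 v2] v3] [[w1 w2] w3]; rewrite !memM => /eqP [c1 c2 c3] /eqP [e1 e2 e3].
  rewrite /big_form /= !z ?subr0 // ?size_F ?size_Fg ?size_XsubC_mul ?g_neq0 ?size_g //.
  - by rewrite !lead_coef_F.
  - by rewrite !lead_coefM !lead_coefXsubC.
  - by rewrite ![lead_coef (_ * g)]lead_coefM !lead_coef_F.
have dV : dim V = ((n + 3 + m) + (n + 3 + m) + (m.+1 + m.+1) + ((n + 3) + (n
  + 3)))%N by [].
have dW : dim W = (1 * (n + 3 + m) + 1 * m.+1 + 1 * (n + 3))%N by [].
by move: dimM; rewrite dV dW; move: (\dim M) => d; clear; lia.
Qed.

Lemma dvd_of_npolyp d (h l : {poly E}) : size h = d.+1 ->
  npolyp d (l %% h) = 0 -> h %| l.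
Proof.
move=> sh e; have h0 : h != 0 by rewrite -size_poly_gt0 sh.
rewrite /dvdp; apply/eqP; have := congr1 (fun q : {poly_d E} => (q : {poly E})) e.
by rewrite npolypK // -ltnS -sh ltn_modp.
Qed.

Let coef (k : {poly E}) (y y' : E) : E := (k.[y] * (y - y'))^-1.

Lemma b_neq0 : b != 0.
Proof.
by apply/eqP => b0; have := g_eval_neq0 (z := y0);
  rewrite g_y0 b0 mul0r eqxx !inE eqxx !orbT => /(_ isT).
Qed.

Lemma g_x x : x \in [:: x0; x1] -> g.[x] = tau.[x] ^+ 2.
Proof.
move=> xin; apply/eqP; rewrite -subr_eq0 -horner_exp -hornerN -hornerD -/(root _ _).
case/dvdpP: g_tau => l ->; rewrite !rootM !root_XsubC.
by move: xin; rewrite !inE => /orP[] /eqP ->; rewrite eqxx ?orbT.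
Qed.

Lemma tau_neq0 z : z \in [:: x0; x1; y0; y1] -> tau.[z] != 0.
Proof.
move=> zin; have := g_eval_neq0 zin; apply: contraNneq => tz.
move: zin; rewrite !inE; case/or4P => /eqP zE; subst z.
- by rewrite g_x ?inE ?eqxx // tz expr0n.
- by rewrite g_x ?inE ?eqxx ?orbT // tz expr0n.
- by rewrite g_y0 tz expr0n mulr0.
- by rewrite g_y1 tz expr0n mulr0.
Qed.

Lemma k_neq0 x z : z != x -> f2.[z] != 0 -> (('X - x%:P) * f2).[z] != 0.
Proof. by move=> zx fz; rewrite hornerM hornerXsubC mulf_neq0 // subr_eq0. Qed.

Lemma coprimep_g_k x : x \in [:: x0; x1] -> coprimep g (('X - x%:P) * f2).
Proof.
move=> xin; rewrite coprimep_sym; apply: coprimep_dvdr cop_fg.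
rewrite /f; move: xin; rewrite !inE => /orP[] /eqP ->.
  by apply/dvdpP; exists (P * ('X - x1%:P)); ring.
by apply/dvdpP; exists (P * ('X - x0%:P)); ring.
Qed.

Lemma big_form_boundary v w : matching v = 0 -> matching w = 0 ->
  big_form v w = form4 b (- coef k0 y0 y1) (- coef k0 y1 y0) (coef k1 y0 y1) (coef k1
    y1 y0) (boundary v) (boundary w).
Proof.
have neq z z' : z != z' -> z - z' != 0 by rewrite subr_eq0.
have [tx0 tx1 ty0 ty1] : [/\ tau.[x0] != 0, tau.[x1] != 0, tau.[y0] != 0 & tau.[y1] != 0].
  by split; apply: tau_neq0; rewrite !inE eqxx ?orbT.
have [gx0 gx1 gy0 gy1] : [/\ g.[x0] != 0, g.[x1] != 0, g.[y0] != 0 & g.[y1] != 0].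
  by split; apply: g_eval_neq0; rewrite !inE eqxx ?orbT.
have sk x : size (('X - x%:P) * f2) = n.+2.
  by rewrite size_XsubC_mul ?f2_neq0 // size_f2.
have gs0 : g %| P * k0 * ('X - x0%:P) - sigma ^+ 2.
  by have -> : P * k0 * ('X - x0%:P) = f by rewrite /k0 /f; ring.
have gs1 : g %| P * k1 * ('X - x1%:P) - sigma ^+ 2.
  by have -> : P * k1 * ('X - x1%:P) = f by rewrite /k1 /f; ring.
have kt0 : k0 %| g - tau ^+ 2.
  apply: dvdp_trans g_tau; apply/dvdpP; exists ('X - x0%:P).
  by rewrite /k0; ring.
have kt1 : k1 %| g - tau ^+ 2.
  apply: dvdp_trans g_tau; apply/dvdpP; exists ('X - x1%:P).
  by rewrite /k1; ring.
have [k00 k01] : k0.[y0] != 0 /\ k0.[y1] != 0.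
  by split; apply: k_neq0 => //; rewrite eq_sym.
have [k10 k11] : k1.[y0] != 0 /\ k1.[y1] != 0.
  by split; apply: k_neq0 => //; rewrite eq_sym.
have x10 : x1 != x0 by rewrite eq_sym.
have x0_in : x0 \in [:: x0; x1] by rewrite !inE eqxx.
have x1_in : x1 \in [:: x0; x1] by rewrite !inE eqxx orbT.
move: v w => [[[p p'] [q q']] [r r']] [[[u u'] [v v']] [w w']].
rewrite /matching /=.
case=> /(dvd_of_npolyp size_g) vq /(dvd_of_npolyp size_g) vq'.
move=> /(dvd_of_npolyp (sk x1)) vr /(dvd_of_npolyp (sk x0)) vr' /eqP.
rewrite subr_eq0 => /eqP vx.
case=> /(dvd_of_npolyp size_g) wq /(dvd_of_npolyp size_g) wq'.
move=> /(dvd_of_npolyp (sk x1)) wr /(dvd_of_npolyp (sk x0)) wr' /eqP.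
rewrite subr_eq0 => /eqP wx.
have D0 := residue_decomposition xy00 xy01 y01 gs0 cop_g_sigma kt0
  (coprimep_g_k x1_in) (k_neq0 x01 f2x0) k00 k01 gx0 gy0 gy1 vq wq vr wr.
have D1 := residue_decomposition xy10 xy11 y01 gs1 cop_g_sigma kt1
  (coprimep_g_k x0_in) (k_neq0 x10 f2x1) k10 k11 gx1 gy0 gy1 vq' wq' vr' wr'.
have Q : (q : {poly E}).[x0] * (v : {poly E}).[x0] / g.[x0] =
         (q' : {poly E}).[x1] * (v' : {poly E}).[x1] / g.[x1].
  have ex (a a' : E) : tau.[x1] * a = tau.[x0] * a' -> a = tau.[x0] / tau.[x1] * a'.
    by move=> ea; apply: (mulfI tx1); rewrite ea; field.
  by rewrite (ex _ _ vx) (ex _ _ wx) (g_x x0_in) (g_x x1_in); field; rewrite tx0 tx1.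
rewrite -/k0 -/F0 in D0; rewrite -/k1 -/F1 in D1.
transitivity
 ((residue_sum (F0 * g) ((p : {poly E}) * u) - residue_sum (('X
   - x0%:P) * g) ((q : {poly E}) * v)
   - residue_sum F0 ((r : {poly E}) * w)) -
  (residue_sum (F1 * g) ((p' : {poly E}) * u') - residue_sum (('X
    - x1%:P) * g) ((q' : {poly E}) * v')
   - residue_sum F1 ((r' : {poly E}) * w'))).
  by rewrite /big_form /=; ring.
rewrite D0 D1 Q g_y0 g_y1 /form4 /norm_polar /boundary /coef /=.
have b0 := b_neq0; have dy : y0 - y1 != 0 by rewrite subr_eq0.
have dy' : y1 - y0 != 0 by rewrite subr_eq0 eq_sym.
move: k00 k01 k10 k11 ty0 ty1.
move: (k0.[y0]) (k0.[y1]) (k1.[y0]) (k1.[y1]) (tau.[y0]) (tau.[y1]) => a a0 a1 a2 a3 a4.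
move=> na na0 na1 na2 na3 na4.
by field; rewrite na na0 na1 na2 na3 na4 dy dy' b0.
Qed.

(** Reduction of the metabolic form big_form leaves a metabolic hermitian form
    of rank 4. Its coefficients involve the unknown values of f2, but each of
    these occurs for x0 and for x1, so the determinant is, up to squares, the
    product below. *)
Lemma norm_of_roots : exists s t : E,
  (y0 - x0) * (y1 - x0) * ((y0 - x1) * (y1 - x1)) = s ^+ 2 - b * t ^+ 2.
Proof.
have neq z z' : z != z' -> z - z' != 0 by rewrite subr_eq0.
have [k00 k01] : k0.[y0] != 0 /\ k0.[y1] != 0.
  by split; apply: k_neq0 => //; rewrite eq_sym.
have [k10 k11] : k1.[y0] != 0 /\ k1.[y1] != 0.
  by split; apply: k_neq0 => //; rewrite eq_sym.
have y10 : y1 - y0 != 0 by rewrite neq // eq_sym.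
have coef_neq0 k z z' : k.[z] != 0 -> z - z' != 0 -> coef k z z' != 0.
  by move=> kz zz; rewrite invr_eq0 mulf_neq0.
have [M [Miso dimM]] := big_form_lagrangian.
have [||U [Uiso dimU]] := lagrangian_reduction big_form_scalar big_form_sym
  big_form_nondeg
  matching_linear boundary_linear _ big_form_boundary _ Miso dimM.
- have -> : dim V = ((n + 3 + m) + (n + 3 + m) + (m.+1 + m.+1) + ((n + 3) + (n
  + 3)))%N by [].
  have -> : dim T = (m + m + (n.+1 + n.+1) + 1)%N by [].
  have -> : dim (norm4 E) = 8 by [].
  clear; lia.
- by move=> u; rewrite /form4 /norm_polar /= !(mulr0, mul0r, subr0, addr0).
have [||||s [t e]] := form4_det b_nonsq _ _ _ _ Uiso dimU.
- by rewrite oppr_eq0 coef_neq0 // neq.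
- by rewrite oppr_eq0 coef_neq0 // neq.
- by rewrite coef_neq0 // neq.
- by rewrite coef_neq0 // neq.
(* N clears f2 and y0 - y1, and inverts the product up to a square. *)
pose N := f2.[y0] * f2.[y1] * (y0 - y1) ^+ 2 * ((y0 - x0) * (y1 - x0) * ((y0
  - x1) * (y1 - x1))).
exists (N * s), (N * t).
have -> : (N * s) ^+ 2 - b * (N * t) ^+ 2 = N ^+ 2 * (s ^+ 2 - b * t ^+ 2) by ring.
rewrite -e /coef /N /k0 /k1 !evalE; field.
have sub_neq0 z z' : z != z' -> z - z' != 0 by rewrite subr_eq0.
by rewrite f2y0 f2y1 !sub_neq0 // eq_sym.
Qed.

End Reciprocity.

(** * A unit of E[X]/(f) with prescribed values *)

(** Sylvester's identity, from the two block triangular factorisations of the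
    matrix with rows (1, - C) and (D, 1). *)
Lemma det_1DmulC (R : comPzRingType) m n (C : 'M[R]_(m, n)) (D : 'M[R]_(n, m)) :
  \det (1%:M + C *m D) = \det (1%:M + D *m C).
Proof.
have e : block_mx 1%:M 0 D 1%:M *m block_mx 1%:M (- C) 0 (1%:M + D *m C) =
         block_mx (1%:M + C *m D) (- C) 0 1%:M *m block_mx 1%:M 0 D 1%:M.
  rewrite !mulmx_block !(mul1mx, mulmx1, mul0mx, mulmx0, addr0, add0r).
  by rewrite mulmxN mulNmx addrK addrCA addNr addr0.
have := congr1 determinant e; rewrite !det_mulmx !det_lblock !det_ublock !det1.
by rewrite !mul1r !mulr1 => ->.
Qed.

Section PolyQuotientRing.
Variables (E : fieldType) (f : {poly E}).
Hypothesis f0 : f != 0.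

Lemma polyn_mul (u v : polyquo f) :
  (u * v : polyquo f) = ((u : {poly E}) * (v : {poly E})) %% f :> {poly E}.
Proof. exact: polyquo_classE. Qed.

Lemma polyn_one : (1 : polyquo f) = 1 %% f :> {poly E}.
Proof. exact: polyquo_classE. Qed.

Lemma eq_modp_dvd (p q : {poly E}) : (p %% f == q %% f) = (f %| p - q).
Proof. by rewrite -subr_eq0 -modpN -modpD. Qed.

End PolyQuotientRing.

Section Interpolation.
Variables (E : fieldType) (b y0 y1 : E) (R : {poly E}).
Hypotheses (b0 : b != 0) (y01 : y0 != y1) (Ry0 : R.[y0] != 0) (Ry1 : R.[y1] != 0).

Let f := ('X - y0%:P) * ('X - y1%:P) * R.
Let d := (size f).-1.
(** The idempotents of E[X]/(f) that belong to the simple roots y0 and y1. *)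
Let e0 := ((y0 - y1) * R.[y0])^-1 *: (('X - y1%:P) * R).
Let e1 := ((y1 - y0) * R.[y1])^-1 *: (('X - y0%:P) * R).

Lemma cofactor_neq0 : R != 0. Proof. by apply: contraNneq Ry0 => ->; rewrite horner0. Qed.
Lemma modulus_neq0 : f != 0. Proof. by rewrite !mulf_neq0 ?polyXsubC_eq0 //
  cofactor_neq0. Qed.

Lemma size_modulus : size f = (size R).+2.
Proof. by rewrite /f -mulrA !size_mul ?mulf_neq0 ?polyXsubC_eq0 ?cofactor_neq0 //
  !size_XsubC. Qed.

Lemma size_idempotents : (size e0 <= d)%N /\ (size e1 <= d)%N.
Proof.
by split; apply: leq_trans (size_scale_leq _ _) _;
  rewrite size_mul ?polyXsubC_eq0 ?cofactor_neq0 // size_XsubC /d size_modulus.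
Qed.

Lemma idempotents_eval : [/\ e0.[y0] = 1, e0.[y1] = 0, e1.[y0] = 0 & e1.[y1] = 1].
Proof.
have yy : y0 - y1 != 0 by rewrite subr_eq0.
have yy' : y1 - y0 != 0 by rewrite subr_eq0 eq_sym.
rewrite /e0 /e1 !evalE !subrr !(mul0r, mulr0).
by split=> //; rewrite mulVf // mulf_neq0.
Qed.

Let unit_poly (u : E) := 1 + (u - 1) *: (e0 + e1).

Lemma unit_poly_eval u : (unit_poly u).[y0] = u /\ (unit_poly u).[y1] = u.
Proof.
have [e00 e01 e10 e11] := idempotents_eval.
by split; rewrite /unit_poly hornerD horner1 hornerZ hornerD ?e00 ?e01 ?e10 ?e11; ring.
Qed.

Lemma cofactor_dvd_idempotents : R %| e0 /\ R %| e1.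
Proof. by split; rewrite /e0 /e1 -mul_polyC !dvdp_mull. Qed.

Lemma cofactor_dvd_unit_poly u : R %| unit_poly u - 1.
Proof.
have [d0 d1] := cofactor_dvd_idempotents.
by rewrite /unit_poly addrC addKr -mul_polyC dvdp_mull // dvdp_add.
Qed.

Lemma modulus_dvd p : R %| p -> p.[y0] = 0 -> p.[y1] = 0 -> f %| p.
Proof.
move=> Rp p0 p1.
have c01 : coprimep ('X - y0%:P) ('X - y1%:P).
  by rewrite coprimep_XsubC root_XsubC eq_sym.
rewrite /f Gauss_dvdp; last first.
  by rewrite coprimepMl ![coprimep _ R]coprimep_sym !coprimep_XsubC /root Ry0 Ry1.
by rewrite Rp andbT Gauss_dvdp // !dvdp_XsubCl /root p0 p1 eqxx.
Qed.

Let alpha : polyquo f := polyquo_class f (unit_poly b).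

Lemma size_unit_poly u : (size (unit_poly u) <= d)%N.
Proof.
have [s0 s1] := size_idempotents.
apply: leq_trans (size_polyD _ _) _; rewrite geq_max size_poly1.
apply/andP; split; first by rewrite /d size_modulus.
apply: leq_trans (size_scale_leq _ _) _.
by apply: leq_trans (size_polyD _ _) _; rewrite geq_max s0.
Qed.

Lemma small_modp (p : {poly E}) : (size p <= d)%N -> p %% f = p.
Proof. by move=> sp; rewrite modp_small // (leq_ltn_trans sp) // /d prednK //
  size_poly_gt0 modulus_neq0. Qed.

Lemma alphaE : alpha = unit_poly b :> {poly E}.
Proof. by rewrite polyquo_classE ?modulus_neq0 // small_modp // size_unit_poly. Qed.

Lemma alpha_unit : is_unit alpha.
Proof.
exists (polyquo_class f (unit_poly b^-1)); apply: polyquo_eq => f0.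
rewrite polyn_mul // polyn_one // polyquo_classE // alphaE modp_mul.
apply/eqP; rewrite eq_modp_dvd.
have [ab0 ab1] := unit_poly_eval b; have [ac0 ac1] := unit_poly_eval b^-1.
apply: modulus_dvd; rewrite ?hornerD ?hornerN ?hornerM ?horner1 ?ab0 ?ab1 ?ac0 ?ac1
  ?mulfV ?subrr //.
have -> : unit_poly b * unit_poly b^-1 - 1 = unit_poly b * (unit_poly b^-1 - 1)
  + (unit_poly b - 1) by ring.
by rewrite dvdp_add ?dvdp_mull ?cofactor_dvd_unit_poly.
Qed.

(** Multiplication by alpha is the identity plus an operator of rank 2, whose
    image is spanned by e0 and e1; Sylvester's identity turns its determinant
    into one of size 2. *)
Lemma alpha_norm : polyquo_norm alpha = b ^+ 2.
Proof.
have [s0 s1] := size_idempotents; have [e00 e01 e10 e11] := idempotents_eval.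
have [ab0 ab1] := unit_poly_eval b; have [R0 R1] := cofactor_dvd_idempotents.
pose C : 'M[E]_(d, 2) := \matrix_(i, j) ((if j == 0 then y0 else y1) ^+ i).
pose D : 'M[E]_(2, d) := \matrix_(i, j) ((b - 1) * (if i == 0 then e0 else e1)`_j).
rewrite /polyquo_norm; have -> : (\matrix_(i < d, j < d)
    (polyn (alpha * polyquo_class f 'X^i : polyquo f))`_j) = 1%:M + C *m D.
  apply/matrixP => i j; rewrite !mxE big_ord_recl big_ord1 !mxE /=.
  rewrite polyn_mul ?modulus_neq0 // polyquo_classE ?modulus_neq0 // alphaE modp_mul.
  have sX : (size ('X^i : {poly E}) <= d)%N by rewrite size_polyXn.
  set S := (b - 1) *: (y0 ^+ i *: e0 + y1 ^+ i *: e1).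
  have sS : (size ('X^i + S)%R <= d)%N.
    apply: leq_trans (size_polyD _ _) _; rewrite geq_max sX.
    apply: leq_trans (size_scale_leq _ _) _.
    apply: leq_trans (size_polyD _ _) _; rewrite geq_max.
    by apply/andP; split; apply: leq_trans (size_scale_leq _ _) _.
  have -> : (unit_poly b * 'X^i) %% f = 'X^i + S.
    rewrite -(small_modp sS); apply/eqP; rewrite eq_modp_dvd.
    have S_eval z : S.[z] = (b - 1) * (y0 ^+ i * e0.[z] + y1 ^+ i * e1.[z]).
      by rewrite /S hornerZ hornerD (hornerZ (y0 ^+ i) e0) (hornerZ (y1 ^+ i) e1).
    apply: modulus_dvd; first last.
    - by rewrite hornerD hornerN hornerM (hornerD 'X^i S) hornerXn ab1 S_eval e01 e11;
      ring.
    - by rewrite hornerD hornerN hornerM (hornerD 'X^i S) hornerXn ab0 S_eval e00 e10;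
      ring.
    have -> : unit_poly b * 'X^i - ('X^i + (b - 1) *: (y0 ^+ i *: e0 + y1 ^+ i *: e1)) =
       (unit_poly b - 1) * 'X^i - (((b - 1) * y0 ^+ i)%:P * e0 + ((b
         - 1) * y1 ^+ i)%:P * e1).
      by rewrite scalerDr (scalerA _ _ e0) (scalerA _ _ e1) !mul_polyC; ring.
    apply: dvdp_sub; first by apply: dvdp_mulr; apply: cofactor_dvd_unit_poly.
    by apply: dvdp_add; apply: dvdp_mull.
  rewrite coefD coefXn /S coefZ coefD !coefZ eq_sym -[_ == j](inj_eq val_inj) /=.
  by congr (_ + _); ring.
rewrite det_1DmulC.
have -> : 1%:M + D *m C = b%:M.
  apply/matrixP => i j; rewrite !mxE.
  have -> : \sum_k D i k * C k j = (b - 1) * (if i == 0 then e0 else e1).[if j == 0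
    then y0 else y1].
    rewrite (horner_coef_wide _ (_ : (size (if i == 0%R then e0 else e1) <= d)%N));
      last by case: ifP.
    by rewrite mulr_sumr; apply: eq_bigr => k _; rewrite !mxE mulrA.
  have [/eqP -> | i1] := boolP (i == 0); have [/eqP -> | j1] := boolP (j == 0).
  - by rewrite e00 eqxx ?mulr1n ?mulr0n; ring.
  - by rewrite e01 eq_sym (negPf j1) ?mulr1n ?mulr0n; ring.
  - by rewrite e10 (negPf i1) ?mulr1n ?mulr0n; ring.
  - have -> : i = j by apply/val_inj; case: i j i1 j1 => [[|[|?]] ?] [[|[|?]] ?].
    by rewrite e11 eqxx ?mulr1n ?mulr0n; ring.
by rewrite det_scalar.
Qed.

Lemma interpolating_unit : exists al : polyquo f,
  [/\ is_unit al, polyquo_norm al = b ^+ 2,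
      (al : {poly E}).[y0] = b /\ (al : {poly E}).[y1] = b & R %| (al : {poly E}) - 1].
Proof.
exists alpha; split; [exact: alpha_unit | exact: alpha_norm | |]; rewrite alphaE.
  exact: unit_poly_eval.
exact: cofactor_dvd_unit_poly.
Qed.

End Interpolation.

(** * Anisotropic ternary forms and the choice of the four roots *)

Lemma anisotropic_ternary (E : fieldType) (V : vectType E) (q : V -> E) :
  2%N \notin [pchar E] -> quadratic_form q -> anisotropic q -> (2 < \dim {:V})%N ->
  exists b a : E, forall x y z : E,
    x ^+ 2 - b * y ^+ 2 - a * z ^+ 2 = 0 -> [/\ x = 0, y = 0 & z = 0].
Proof.
move=> char2 [qZ Blin] qan dimV.
have two : (2 : E) != 0 by apply: contraNneq char2 => e; rewrite inE /= e eqxx.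
have Bsym x y : polar q x y = polar q y x by rewrite /polar [y + x]addrC; ring.
have qD x y : q (x + y) = q x + q y + polar q x y by rewrite /polar; ring.
have Bxx x : polar q x x = 2 * q x.
  by rewrite /polar -mulr2n -scaler_nat qZ; ring.
have Bxx0 x : x != 0 -> polar q x x != 0.
  by rewrite Bxx => x0; rewrite mulf_neq0 //; apply: contraNneq x0 => /qan ->.
have BDl x y z a : polar q (a *: x + y) z = a * polar q x z + polar q y z.
  by rewrite Bsym Blin ![polar q z _]Bsym.
have next (N : {vspace V}) : (\dim N <= 2)%N ->
    exists e, e != 0 /\ forall y, y \in N -> polar q e y = 0.
  move=> dN; have [O [memO dimO]] := orthogonal_subspace Blin Bsym N.
  exists (vpick O); split; last by apply/memO; exact: memv_pick.
  by rewrite vpick0 -dimv_eq0; move: dimV dimO; rewrite dimvf; lia.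
have [|e1 [e10 _]] := next 0%VS; first by rewrite dimv0.
have [|e2 [e20 e2N]] := next <[e1]>%VS; first by rewrite dim_vline e10.
have [|e3 [e30 e3N]] := next (<[e1]> + <[e2]>)%VS.
  by apply: leq_trans (dimv_add_leqif _ _) _; rewrite !dim_vline e10 e20.
have B21 : polar q e2 e1 = 0 by apply: e2N; exact: memv_line.
have B31 : polar q e3 e1 = 0 by apply/e3N/(subvP (addvSl _ _)); exact: memv_line.
have B32 : polar q e3 e2 = 0 by apply/e3N/(subvP (addvSr _ _)); exact: memv_line.
have Bz y : polar q y 0 = 0.
  by have := Blin y (-1) 0 0; rewrite scaler0 addr0 mulN1r addNr.
have B0 y a x : polar q y (a *: x) = a * polar q y x.
  by have := Blin y a x 0; rewrite addr0 Bz addr0.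
have q1 : q e1 != 0 by apply: contraNneq e10 => /qan ->.
exists (- (q e1 * q e2)), (- (q e1 * q e3)) => x y z xyz.
pose v := (x / q e1) *: e1 + (y *: e2 + z *: e3).
have v0 : v = 0.
  apply: qan; rewrite /v !qD !qZ.
  have BZl y' a x' : polar q (a *: x') y' = a * polar q x' y' by rewrite Bsym B0 Bsym.
  rewrite !BZl Blin !B0 !(Bsym e1) (Bsym e2) B21 B31 B32.
  have -> : y ^+ 2 * q e2 = (y ^+ 2 * q e2 * q e1) / q e1 by rewrite mulfK.
  have -> : z ^+ 2 * q e3 = (z ^+ 2 * q e3 * q e1) / q e1 by rewrite mulfK.
  transitivity ((x ^+ 2 - - (q e1 * q e2) * y ^+ 2 - - (q e1 * q e3) * z ^+ 2) / q e1).
    by field.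
  by rewrite xyz mul0r.
have Bv w : polar q v w = x / q e1 * polar q e1 w + (y * polar q e2 w + z * polar q e3 w).
  rewrite /v BDl BDl; congr (_ + (_ + _)).
  by rewrite Bsym B0 Bsym.
have B0w w : polar q v w = 0.
  by rewrite v0 Bsym; exact: Bz.
have x0 : x / q e1 = 0.
  have := B0w e1; rewrite Bv B21 B31 !mulr0 !addr0 => /eqP.
  by rewrite mulf_eq0 (negPf (Bxx0 _ e10)) orbF => /eqP.
have y0 : y = 0.
  have := B0w e2; rewrite Bv x0 B32 mul0r add0r mulr0 addr0 => /eqP.
  by rewrite mulf_eq0 (negPf (Bxx0 _ e20)) orbF => /eqP.
have z0 : z = 0.
  have := B0w e3; rewrite Bv x0 y0 !mul0r !add0r => /eqP.
  by rewrite mulf_eq0 (negPf (Bxx0 _ e30)) orbF => /eqP.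
split=> //; move/eqP: x0; rewrite mulf_eq0 invr_eq0 (negPf q1) orbF.
by move/eqP.
Qed.

(** The four points 0, c, 1, d have cross-ratio a, so that the product in
    norm_of_roots is a times a square. Solving for d gives c / (1 + a (c - 1)), and
    the points are distinct when c is neither 0 nor 1 and the denominator is
    nonzero. *)
Lemma cross_ratio_points (E : fieldType) (a b : E) :
  (forall x y z : E, x ^+ 2 - b * y ^+ 2 - a * z ^+ 2 = 0 ->
     [/\ x = 0, y = 0 & z = 0]) ->
  2%N \notin [pchar E] ->
  exists c d : E, [/\ uniq [:: 0; c; 1; d], d * (c - 1) != 0
    & (1 - 0) * (d - 0) * ((1 - c) * (d - c)) = a * (d * (c - 1)) ^+ 2].
Proof.
move=> abP char2.
have two : (2 : E) != 0 by apply: contraNneq char2 => e; rewrite inE /= e eqxx.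
have one0 : (1 : E) <> 0 by apply/eqP/oner_neq0.
have a1 : a != 1.
  by apply/eqP => a1; have [|] := abP 1 0 1; first by rewrite a1; ring.
have b1 : b != 1.
  by apply/eqP => b1; have [|] := abP 1 1 0; first by rewrite b1; ring.
have a0 : a != 0.
  by apply/eqP => a0; have [|_ _] := abP 0 0 1; first by rewrite a0; ring.
have b0 : b != 0.
  by apply/eqP => b0; have [|_ ] := abP 0 1 0; first by rewrite b0; ring.
have [c [c0 c1 k0]] : exists c, [/\ c != 0, c != 1 & 1 + a * (c - 1) != 0].
  (* If both b and - 1 fail, then a = 1 / 2 and b = - 1, and x = y = 1, z = 2 is
     a nontrivial zero. *)
  have [kb|kb] := eqVneq (1 + a * (b - 1)) 0; last by exists b.
  exists (-1); split; first by rewrite oppr_eq0 oner_eq0.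
    by rewrite eq_sym -addr_eq0 -mulr2n.
  apply/eqP => k1; have a2 : 2 * a = 1.
    by rewrite -[LHS]addr0 -k1; ring.
  suff iso : 1 ^+ 2 - b * 1 ^+ 2 - a * 2 ^+ 2 = 0 by have [/one0] := abP _ _ _ iso.
  have -> : b = -1.
    apply: (mulfI a0); transitivity (a - 2 * a); last by ring.
    by rewrite a2 -[LHS]subr0 -kb; ring.
  have -> : 1 ^+ 2 - -1 * 1 ^+ 2 - a * 2 ^+ 2 = 2 * (1 - 2 * a) by ring.
  by rewrite a2 subrr mulr0.
pose k := 1 + a * (c - 1); exists c, (c / k).
have cm1 : c - 1 != 0 by rewrite subr_eq0.
have d0 : c / k != 0 by rewrite mulf_neq0 // invr_eq0.
have cd : c != c / k.
  rewrite -subr_eq0; have -> : c - c / k = c / k * (a * (c - 1)) by rewrite /k; field.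
  by rewrite !mulf_neq0 ?invr_eq0.
have d1 : 1 != c / k.
  rewrite -subr_eq0; have -> : 1 - c / k = (a - 1) * (c - 1) / k by rewrite /k; field.
  by rewrite !mulf_neq0 ?invr_eq0 ?subr_eq0.
split; last by rewrite /k; field.
  by rewrite /= !inE !negb_or ![0 == _]eq_sym c0 oner_eq0 d0 c1 cd d1.
by rewrite mulf_neq0.
Qed.

(** * Square-free polynomials *)

Section SquareFree.
Variable E : fieldType.

Lemma is_unit_size (p : {poly E}) : is_unit p -> size p = 1%N.
Proof.
case=> r pr; have : p \is a GRing.unit.
  by apply/unitrP; exists r; rewrite mulrC pr.
by rewrite poly_unitE => /andP[/eqP].
Qed.

Lemma square_free_prod (rs : seq E) : uniq rs -> square_free (\prod_(z <- rs) ('X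
  - z%:P)).
Proof.
rewrite -separable_prod_XsubC => sep [y [z [nu e]]].
have : coprimep y y.
  by case/separable_polyP: sep => c _; apply: c; rewrite e expr2 dvdp_mulr.
rewrite coprimepp => /size_poly1P [c c0 yc]; apply: nu.
by exists (c^-1)%:P; rewrite yc -polyCM mulfV.
Qed.

Lemma square_free_root (p r : {poly E}) z :
  square_free (('X - z%:P) * p * r) -> (p * r).[z] != 0.
Proof.
move=> sf; apply/negP => /factor_theorem [l e]; apply: sf.
exists ('X - z%:P), l; split; last by rewrite -mulrA e; ring.
by move=> /is_unit_size; rewrite size_XsubC.
Qed.

End SquareFree.

(** * Conclusion *)

Theorem proposition4p4 (E : fieldType)
    (char_neq2 : 2%N \notin [pchar E])
    (deg4 : forall h : {poly E},
       h \is monic -> square_free h -> size h = 5%N ->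
       exists2 f : {poly E}, square_reflexive f & h %| f) :
  (u_invariant E <= (2%:Z)%:E)%E.
Proof.
apply/u_invariant_le => k [V [q [qf _ qan dimV]]].
rewrite leqNgt -dimV; apply/negP => dim3.
have [b [a abP]] := anisotropic_ternary char_neq2 qf qan dim3.
have b_nonsq u v : u ^+ 2 - b * v ^+ 2 = 0 -> u = 0 /\ v = 0.
  by move=> e; have [] := abP u v 0; first by rewrite e; ring.
have b0 : b != 0.
  apply/eqP => e; have [|_ /eqP] := b_nonsq 0 1; first by rewrite e; ring.
  by rewrite oner_eq0.
have [x1 [y1 [un d0 cr]]] := cross_ratio_points abP char_neq2.
(* By the choice of the points, this s^2 - b t^2 is a times a nonzero square,
   against the anisotropy of x^2 - b y^2 - a z^2. *)
suff [s [t e]] : exists s t : E,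
    (1 - 0) * (y1 - 0) * ((1 - x1) * (y1 - x1)) = s ^+ 2 - b * t ^+ 2.
  have [|_ _ z0] := abP s t (y1 * (x1 - 1)); first by rewrite -e cr subrr.
  by rewrite z0 eqxx in d0.
move: un; set x0 : E := 0; set y0 : E := 1 => un.
have [f [_ sf refl] hf] : exists2 f : {poly E}, square_reflexive f &
    \prod_(z <- [:: x0; x1; y0; y1]) ('X - z%:P) %| f.
  apply: deg4; [exact: monic_prod_XsubC | exact: square_free_prod |].
  by rewrite size_prod_XsubC.
have := un; rewrite /= !inE !negb_or andbT.
case/and3P => /and3P[x01 xy00 xy01] /andP[xy10 xy11] y01.
case/dvdpP: hf => f2; rewrite !big_cons big_nil mulr1 => ef.
pose P := ('X - y0%:P) * ('X - y1%:P).
pose R := ('X - x0%:P) * ('X - x1%:P) * f2.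
have fE : f = P * R by rewrite ef /P /R; ring.
have simple z p r : f = ('X - z%:P) * p * r -> p.[z] != 0 /\ r.[z] != 0.
  move=> e; rewrite e in sf; have := square_free_root sf.
  by rewrite hornerM mulf_eq0 negb_or => /andP.
have [_ f2x0] : (P * ('X - x1%:P)).[x0] != 0 /\ f2.[x0] != 0.
  by apply: simple; rewrite ef /P; ring.
have [_ f2x1] : (P * ('X - x0%:P)).[x1] != 0 /\ f2.[x1] != 0.
  by apply: simple; rewrite ef /P; ring.
have [_ Ry0] : ('X - y1%:P).[y0] != 0 /\ R.[y0] != 0.
  by apply: simple; rewrite ef /R; ring.
have [_ Ry1] : ('X - y0%:P).[y1] != 0 /\ R.[y1] != 0.
  by apply: simple; rewrite ef /R; ring.
have f2y0 : f2.[y0] != 0 by move: Ry0; rewrite hornerM mulf_eq0 negb_or => /andP[].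
have f2y1 : f2.[y1] != 0 by move: Ry1; rewrite hornerM mulf_eq0 negb_or => /andP[].
have f0 : f != 0.
  rewrite fE !mulf_neq0 ?polyXsubC_eq0 //.
  by apply: contraNneq f2x0 => ->; rewrite horner0.
have [al [al_unit al_norm [al0 al1] al_R]] := interpolating_unit b0 y01 Ry0 Ry1.
rewrite -/P -fE in al al_unit al_norm al0 al1 al_R.
have [|g [cop_gf [_ [t t_unit ->] galpha] [s s_unit fs]]] := refl al al_unit.
  left; rewrite al_norm; exists b => //.
  by exists b^-1; rewrite mulfV.
have cop_fg : coprimep f g by rewrite coprimep_sym.
have g0 : g != 0.
  have gx0 : g.[x0] != 0.
    apply: (coprimep_root cop_fg); rewrite ef !rootM root_XsubC eqxx.
    by rewrite orbT.
  by apply: contraNneq gx0 => ->; rewrite horner0.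
pose sigma : {poly E} := s; pose tau : {poly E} := t.
have g_sigma : g %| f - sigma ^+ 2.
  rewrite -eq_modp_dvd; apply/eqP.
  have := congr1 (fun u : polyquo g => (u : {poly E})) fs.
  by rewrite polyquo_classE // expr2 polyn_mul // expr2.
have g_alpha : f %| g - (al : {poly E}) * tau ^+ 2.
  rewrite -eq_modp_dvd; apply/eqP.
  have := congr1 (fun u : polyquo f => (u : {poly E})) galpha.
  by rewrite polyquo_classE // !expr2 !polyn_mul // modp_mul.
have g_val z : f.[z] = 0 -> g.[z] = (al : {poly E}).[z] * tau.[z] ^+ 2.
  move=> fz; apply/eqP; rewrite -subr_eq0 -horner_exp -hornerM -hornerN -hornerD.
  by case/dvdpP: g_alpha => l ->; rewrite hornerM fz mulr0.
have fy0 : f.[y0] = 0 by rewrite fE /P !hornerM !hornerXsubC subrr !mul0r.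
have fy1 : f.[y1] = 0 by rewrite fE /P !hornerM !hornerXsubC subrr mulr0 mul0r.
have g_tau : R %| g - tau ^+ 2.
  have -> : g - tau ^+ 2 = (g - (al : {poly E}) * tau ^+ 2) + ((al : {poly E})
    - 1) * tau ^+ 2 by ring.
  apply: dvdp_add; last exact: dvdp_mulr.
  by apply: dvdp_trans g_alpha; rewrite fE dvdp_mull.
have ff : P * ('X - x0%:P) * ('X - x1%:P) * f2 = f by rewrite fE /R; ring.
have sz_g : size g = (size g).-1.+1 by rewrite prednK // size_poly_gt0.
have sz_f2 : size f2 = (size f2).-1.+1.
  rewrite prednK // size_poly_gt0.
  by apply: contraNneq f2x0 => ->; rewrite horner0.
by apply: (norm_of_roots b_nonsq (sigma := sigma) (tau := tau) (g := g) x01 y01 xy00 xy01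
  xy10 xy11 f2x0 f2x1 f2y0 f2y1) sz_g sz_f2; rewrite -/P ?ff ?g_val ?al0 ?al1.
Qed.
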